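(* Let $C\subset\mathbb{R}^n$, let $r:[0,\infty)\to\mathbb{R}$ be a piecewise continuous switching signal, and consider the switched system $\dot x=f(x,r(t))$, where: (1) on $C$ and for $t\ge 0$, $f$ is continuous with respect to $(x,r)$, continuously differentiable with respect to $x$, and there is a Lebesgue measurable function $m(t)$ with $|f(x,r(t))|\le m(t)$ for all $x\in C$ and $t\ge 0$; (2) $|\cdot|_{\chi(t)}$ is a switched norm on $\mathbb{R}^n$ that is right regular at every time except at the time instants $\{\tilde t_j\}_{j\ge1}$, is right-continuous and uniformly equivalent, and whose left limit $|\cdot|_{\chi(\tilde t_j-)}$ exists at each $\tilde t_j$; (3) $C$ is a $\kappa$-reachable set and is forward invariant for $\dot x=f(x,r(t))$. Suppose that there exist a measurable function $\alpha(t)$, nonnegative constants $\beta_j$, $j=1,2,\dots$, and constants $c>0$ and $T_0>0$ such that $$\nu_{\chi(t)}\left(\frac{\partial f}{\partial x}(x,r(t))\right)\le\alpha(t)\quad\text{for all } t\ne\tilde t_j \text{ and all } x\in C,$$ $$|\cdot|_{\chi(\tilde t_j)}\le\beta_j\,|\cdot|_{\chi(\tilde t_j-)}\quad\text{for all } j,$$ and, for all $T>T_0$, $$\frac1T\left[\int_{t_0}^{t_0+T}\alpha(t)\,dt+\sum_{j:\ t_0<\tilde t_j<t_0+T}\log\beta_j\right]<-c,\qquad( * )$$ where $t_0$ is the starting time. Then the system $\dot x=f(x,r(t))$ is incrementally exponentially asymptotically stable ($\delta EAS$) in $C$ with respect to $r(t)$. If $( * )$ holds for some $c>0$ independent of $t_0$,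 then the system is incrementally uniformly exponentially asymptotically stable ($\delta UEAS$) with respect to $r(t)$ in $C$. In addition, the exponential convergence rate can be estimated as $O(\exp(-c(t-t_0)))$.
   Context: Piecewise continuous (PWC): $r$ has a countable increasing sequence of discontinuity points, at each of which the one-sided limits exist and $r(t_i)=r(t_i+)$. Solutions are Carathéodory solutions; $\phi(t;t_0,x_0,r_t)$ denotes the (unique) solution of $\dot x=f(x,r(t))$ with $x(t_0)=x_0$, where $r_t=\{r(s)\}_{t_0\le s\le t}$. Switched norm: for each index $\chi$, $|\cdot|_\chi$ is a norm on $\mathbb{R}^n$ (also denoting the induced matrix norm); $\chi(t)$ is a PWC function of time, so that $|\cdot|_{\chi(t)}$ is a time-dependent norm. Its one-sided limits are $|x|_{\chi(t\pm)}=\lim_{h\to0\pm}|x|_{\chi(t+h)}$, when these exist for all $x$. It is right-continuous at $t$ if $|x|_{\chi(t+)}=|x|_{\chi(t)}$ for all $x$. It is uniformly equivalent if there is $D>0$ with $|x|_{\chi(t)}\le D|x|_{\chi(s)}$ for all $x\in\mathbb{R}^n$ and all times $t,s$. It is right regular at $t$ if $$\overline{\partial}_t(|\cdot|_{\chi(t)})=\limsup_{h\to0+}\ \sup_{|x|_{\chi(t)}=1}\frac{|x|_{\chi(t+h)}-1}{h}$$ exists. The switched matrix measure of $A\in\mathbb{R}^{n\times n}$ is $$\nu_{\chi(t)}(A)=\limsup_{h\to0+}\frac1h\sup_{|x|_{\chi(t)}=1}\left[|(I_n+hA)x|_{\chi(t+h)}-1\right],$$ if this exists. The instants $\tilde t_1<\tilde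 t_2<\cdots$ are such that only finitely many lie in any bounded time interval. $C$ is $\kappa$-reachable if there is a constant $\kappa>0$ such that for all $x_0,y_0\in C$ there is a continuously differentiable curve $\gamma:[0,1]\to C$ with $\gamma(0)=x_0$, $\gamma(1)=y_0$ and $|\gamma'(s)|_{\chi(t_0)}\le\kappa|x_0-y_0|_{\chi(t_0)}$ for all $s\in[0,1]$, with $\kappa$ independent of $x_0,y_0$. A continuous function $\alpha:[0,a)\to[0,\infty)$ is of class $\mathcal{K}$ if it is strictly increasing with $\alpha(0)=0$. A continuous $\beta(\rho,t):[0,a)\times[0,\infty)\to[0,\infty)$ is of class $\mathcal{KL}$ if $\beta(\cdot,t)$ is of class $\mathcal K$ for each fixed $t$, and for each fixed $\rho$, $\beta(\rho,t)$ is decreasing in $t$ with $\lim_{t\to\infty}\beta(\rho,t)=0$; it is of class $\mathcal{EKL}$ if in addition it converges to $0$ exponentially as $t\to\infty$. The system is $\delta EAS$ in $C$ with respect to $r(t)$ if there is $\beta$ of class $\mathcal{EKL}$ (possibly depending on the starting time $t_0$) such that for any $x_0,y_0\in C$ and any starting time $t_0$, $|\phi(t+t_0;t_0,x_0,r_t)-\phi(t+t_0;t_0,y_0,r_t)|\le\beta(|x_0-y_0|,t)$ for some norm $|\cdot|$. It is $\delta UEAS$ if $\beta$ can be chosen independently of $t_0$.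
   Formalization: Added, as the claim fails without them: the switched norm is left-continuous at all times other than the t̃_j; and, for δUEAS only, T_0 is independent of t_0 and the bracket in ( * ) is bounded above over all t_0≥0, 0≤T≤T_0. Also ∂f/∂x is read as continuous in (x,r). *)

(* Defs.v *)
From HB Require Import structures.
From mathcomp Require Import all_boot all_order all_algebra.
From mathcomp Require Import all_classical all_reals all_analysis.

Set Implicit Arguments.
Unset Strict Implicit.
Unset Printing Implicit Defensive.

Import Order.TTheory GRing.Theory Num.Theory.
Import numFieldNormedType.Exports.

Local Open Scope classical_set_scope.
Local Open Scope ring_scope.

(* The real line with the Lebesgue (completed Borel) sigma-algebra; the
   canonical measurable structure on R itself is the Borel one. *)
Definition lebesgueR (R : realType) :=
  caratheodory_type (measure_extension.mu_ext (@wlength R idfun)).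

Definition lebesgue_measurable_fun (R : realType) (D : set R) (g : R -> R) :=
  measurable_fun (D : set (lebesgueR R)) (g : lebesgueR R -> R).

Definition lebesgue_integrable (R : realType) (D : set R) (g : R -> R) :=
  (@completed_lebesgue_measure R).-integrable D (EFin \o g).

Definition lebesgue_int (R : realType) (a b : R) (g : R -> R) : R :=
  \int[@completed_lebesgue_measure R]_(t in `[a, b]) g t.

(* Time is [0, +oo[: values of time-dependent data at negative times are never
   used.  The sequence d may contain points at which g is continuous, so that
   signals with finitely many discontinuities are covered. *)
Definition piecewise_continuous (R : realType) (S : topologicalType)
    (g : R -> S) : Prop :=
  exists d : nat -> R,
    [/\ forall i, 0 < d i,
        forall i j, (i < j)%N -> d i < d j,
        forall t, 0 <= t -> (forall i, t <> d i) ->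
          g s @[s --> within `[0, +oo[ (nbhs t)] --> g t &
        forall i, (exists l : S, g s @[s --> (d i)^'-] --> l) /\
          g s @[s --> (d i)^'+] --> g (d i)].

Section dynamics.
Context (R : realType) (n : nat).
Implicit Types (f : 'cV[R]_n -> R -> 'cV[R]_n) (r : R -> R).
Implicit Types (C : set 'cV[R]_n) (phi : R -> 'cV[R]_n -> R -> 'cV[R]_n).

(* Carathéodory solution of x' = f(x, r(t)) on [t0, +oo[, in integral form
   (componentwise Lebesgue integral); absolute continuity is implied. *)
Definition caratheodory_solution f r (t0 : R) (x : R -> 'cV[R]_n) : Prop :=
  forall t (i : 'I_n), t0 <= t ->
    lebesgue_integrable `[t0, t] (fun s => f (x s) (r s) i ord0) /\
    x t i ord0 = x t0 i ord0 +
      lebesgue_int t0 t (fun s => f (x s) (r s) i ord0).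

(* [phi t0 x0 t] is phi(t; t0, x0, r_t).  Uniqueness of solutions is not
   required here. *)
Definition solution_map f r C phi : Prop :=
  forall t0 x0, 0 <= t0 -> C x0 ->
    phi t0 x0 t0 = x0 /\ caratheodory_solution f r t0 (phi t0 x0).

Definition forward_invariant f r C : Prop :=
  forall t0 (x : R -> 'cV[R]_n), 0 <= t0 ->
    caratheodory_solution f r t0 x -> C (x t0) ->
    forall t, t0 <= t -> C (x t).

(* Column-vector convention: entry (i, j) is the derivative of the i-th
   component along the j-th coordinate. *)
Definition jacobian_mx (g : 'cV[R]_n -> 'cV[R]_n) (x : 'cV[R]_n) : 'M[R]_n :=
  \matrix_(i, j) ('d g x (delta_mx j ord0) : 'cV[R]_n) i ord0.

Definition is_norm (N : 'cV[R]_n -> R) : Prop :=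
  [/\ forall x y, N (x + y) <= N x + N y,
      forall (a : R) x, N (a *: x) = `|a| * N x &
      forall x, N x = 0 -> x = 0].

(* A C^1 curve on [0, 1] extends to a C^1 curve on the line, so two-sided
   derivability at the end points is no restriction. *)
Definition kappa_reachable (N : 'cV[R]_n -> R) C : Prop :=
  exists2 kappa : R, 0 < kappa & forall x0 y0, C x0 -> C y0 ->
    exists gamma : R -> 'cV[R]_n,
      [/\ gamma 0 = x0 /\ gamma 1 = y0,
          forall s, s \in `[0, 1] -> C (gamma s),
          forall s, s \in `[0, 1] -> derivable gamma s 1,
          {within `[0, 1], continuous (derive1 gamma)} &
          forall s, s \in `[0, 1] ->
            N (derive1 gamma s) <= kappa * N (x0 - y0)].

Section switched_norm.
(* [N k] is the norm of index k, [chi] the switching of the index. *)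
Context (I : Type) (N : I -> 'cV[R]_n -> R) (chi : R -> I).

Definition norm_right_continuous (t : R) : Prop :=
  forall x, N (chi s) x @[s --> t^'+] --> N (chi t) x.

Definition norm_left_limit_exists (t : R) : Prop :=
  forall x, exists l : R, N (chi s) x @[s --> t^'-] --> l.

Definition norm_left (t : R) (x : 'cV[R]_n) : R :=
  lim (N (chi s) x @[s --> t^'-]).

(* The instants of the jump sequence are meant to be the only discontinuities
   in time of the switched norm: right regularity at every time does not by
   itself exclude upward jumps of t |-> N (chi t) x from the left. *)
Definition norm_left_continuous (t : R) : Prop :=
  forall x, N (chi s) x @[s --> t^'-] --> N (chi t) x.

Definition uniformly_equivalent : Prop :=
  exists2 D : R, 0 < D & forall t s x, 0 <= t -> 0 <= s ->
    N (chi t) x <= D * N (chi s) x.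

Definition dini_norm (t : R) : \bar R :=
  limf_esup (fun h : R =>
    ereal_sup [set ((N (chi (t + h)) x - 1) / h)%:E
              | x in [set x | N (chi t) x = 1]]) (0 : R)^'+.

Definition right_regular (t : R) : Prop := dini_norm t \is a fin_num.

Definition matrix_measure (t : R) (A : 'M[R]_n) : \bar R :=
  limf_esup (fun h : R => ((h^-1)%:E *
    ereal_sup [set (N (chi (t + h)) ((1%:M + h *: A) *m x) - 1)%R%:E
              | x in [set x | N (chi t) x = 1%R]])%E) (0 : R)^'+.

End switched_norm.

(* The jump instants are tt 0 < tt 1 < ... (indexed from 0); they do not
   accumulate in the intended use, so that the fsum has finite range. *)
Definition growth_exponent (alpha : R -> R) (tt beta : nat -> R) (t0 T : R)
    : R :=
  lebesgue_int t0 (t0 + T) alpha +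
  \sum_(j \in [set j | t0 < tt j < t0 + T]) ln (beta j).

(* The integrability clause says that the integral makes sense as a real. *)
Definition average_contraction (alpha : R -> R) (tt beta : nat -> R)
    (t0 c T0 : R) : Prop :=
  forall T, T0 < T ->
    lebesgue_integrable `[t0, t0 + T] alpha /\
    T^-1 * growth_exponent alpha tt beta t0 T < - c.

(* Comparison functions on [0, a), with a = +oo allowed. *)
Definition class_K (a : \bar R) (g : R -> R) : Prop :=
  let D := [set u : R | 0 <= u /\ (u%:E < a)%E] in
  [/\ {within D, continuous g},
      forall u, D u -> 0 <= g u,
      forall u v, D u -> D v -> u < v -> g u < g v &
      g 0 = 0].

(* "Decreasing in t" is non-strict, as beta(0, t) = 0 for all t. *)
Definition class_KL (a : \bar R) (beta : R -> R -> R) : Prop :=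
  [/\ {within [set p : R * R | [/\ 0 <= p.1, (p.1%:E < a)%E & 0 <= p.2]],
        continuous (fun p : R * R => beta p.1 p.2)},
      forall t, 0 <= t -> class_K a (beta ^~ t),
      forall u s t, 0 <= u -> (u%:E < a)%E -> 0 <= s -> s <= t ->
        beta u t <= beta u s &
      forall u, 0 <= u -> (u%:E < a)%E -> beta u t @[t --> +oo] --> (0 : R)].

Definition class_EKL (a : \bar R) (beta : R -> R -> R) : Prop :=
  class_KL a beta /\
  exists2 lambda : R, 0 < lambda & forall u, 0 <= u -> (u%:E < a)%E ->
    exists K : R, forall t, 0 <= t -> beta u t <= K * expR (- (lambda * t)).

Definition incremental_bound C phi (N : 'cV[R]_n -> R) (a : \bar R)
    (beta : R -> R -> R) (t0 : R) : Prop :=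
  forall x0 y0, C x0 -> C y0 ->
    ((N (x0 - y0))%:E < a)%E /\
    forall t, 0 <= t ->
      N (phi t0 x0 (t + t0) - phi t0 y0 (t + t0)) <= beta (N (x0 - y0)) t.

Definition dEAS C phi : Prop :=
  exists2 N, is_norm N & forall t0, 0 <= t0 ->
    exists (a : \bar R) (beta : R -> R -> R),
      [/\ (0 < a)%E, class_EKL a beta & incremental_bound C phi N a beta t0].

Definition dUEAS C phi : Prop :=
  exists2 N, is_norm N & exists (a : \bar R) (beta : R -> R -> R),
    [/\ (0 < a)%E, class_EKL a beta &
        forall t0, 0 <= t0 -> incremental_bound C phi N a beta t0].

End dynamics.

(* Main.v *)
(* Two nearby solutions x, y in C satisfy y' - x' = J(x, r) (y - x) + o(|y - x|),
   where the remainder is uniform along x because any two points of C are joined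
   inside C by a curve of comparable length.  Hence v(t) = |y(t) - x(t)|_{chi(t)}
   has upper right Dini derivative at most (alpha(t) + eps) v(t) off the jumps and
   is multiplied by at most beta_j at the j-th jump, which gives
   v(t1) <= exp(int alpha + sum log beta_j + eps) v(t0).  As alpha is merely
   integrable and the Dini bound holds everywhere, the integration of this
   inequality goes through a Vitali-Carathéodory majorant of alpha.

   For distant initial points x0, y0, apply this estimate to infinitesimally close
   points of a curve gamma in C from x0 to y0: s |-> phi(t1; t0, gamma(s)) is
   pointwise Lipschitz, hence so is its total increment.  No differentiability
   with respect to initial conditions, nor uniqueness, is needed. *)

Require Import Defs.
From HB Require Import structures.
From mathcomp Require Import all_boot all_order all_algebra.
From mathcomp Require Import all_classical all_reals all_analysis.
From mathcomp Require Import measurable_realfun ring lra.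

Import Order.TTheory GRing.Theory Num.Theory.
Import numFieldNormedType.Exports.

Local Open Scope classical_set_scope.
Local Open Scope ring_scope.

(** * Real induction and Dini derivatives *)

(** Two features of the data shape the argument. The estimate for two solutions holds only while
    they stay close, and its rate is known only off the jumps. So monotonicity is proved below a
    threshold [zeta], and the finitely many exceptional instants are crossed by upper semicontinuity
    from the right alone. Moreover, constants must not depend on [t0] if the final bounds are to be
    uniform. Each [t0] may come with its own [kappa], so reachability is invoked only for the norm
    at time 0, and uniform equivalence carries the result to other times. The final separations are
    measured in [N (chi 0)]: this is the fixed norm that stability asks for, and it makes the
    separation continuous in time, so that a jump at the final instant can be avoided by a limit
    from the left. *)

Lemma near_at_rightP (R : realType) (t : R) (P : R -> Prop) :
  (\forall s \near t^'+, P s) <->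
  exists2 d, 0 < d & forall s, t < s < t + d -> P s.
Proof.
split.
  case=> d /= d0 H; exists d => // s /andP[ts sd]; apply: H => //=.
  by rewrite /ball_ /= ltr_norml; apply/andP; split; lra.
case=> d d0 H; exists d => //= s /=; rewrite /ball_ /= ltr_norml => /andP[? ?] ?.
by apply: H; apply/andP; split; lra.
Qed.

Lemma near_at_leftP (R : realType) (t : R) (P : R -> Prop) :
  (\forall s \near t^'-, P s) <->
  exists2 d, 0 < d & forall s, t - d < s < t -> P s.
Proof.
split.
  case=> d /= d0 H; exists d => // s /andP[ts sd]; apply: H => //=.
  by rewrite /ball_ /= ltr_norml; apply/andP; split; lra.
case=> d d0 H; exists d => //= s /=; rewrite /ball_ /= ltr_norml => /andP[? ?] ?.
by apply: H; apply/andP; split; lra.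
Qed.

(** Let [c] be the supremum of the [t] such that [P] holds on all of [[a, t]]. The left condition
    gives [P c], and the right condition would push past [c] unless [c = b]. *)
Lemma real_induction (R : realType) (a b : R) (P : R -> Prop) :
  a <= b -> P a ->
  (forall t, a <= t < b -> P t -> \forall s \near t^'+, P s) ->
  (forall t, a < t <= b -> (forall s, a <= s < t -> P s) -> P t) ->
  forall t, a <= t <= b -> P t.
Proof.
move=> ab Pa Pr Pl.
pose A := [set t | a <= t <= b /\ forall s, a <= s <= t -> P s].
have Aa : A a.
  split; first by rewrite lexx.
  by move=> s sa; have -> : s = a by apply/eqP; rewrite eq_le andbC.
have ubA : ubound A b by move=> t [/andP[]].
have supA : has_sup A by split; [exists a | exists b].
pose c := sup A.
have ac : a <= c by apply: sup_upper_bound.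
have cb : c <= b by apply: ge_sup => //; exists a.
have Pc s : a <= s < c -> P s.
  move=> /andP[as_ sc].
  have [t [_ tP] st] := sup_gt (ex_intro _ a Aa) sc.
  by apply: tP; rewrite as_ ltW.
have Pcc : P c.
  have [ac'|ca] := ltP a c; first by apply: Pl => //; rewrite ac' cb.
  by have <- : a = c by apply/eqP; rewrite eq_le ac ca.
have Pc' s : a <= s <= c -> P s.
  by move=> /andP[as_]; rewrite le_eqVlt => /predU1P[->//|sc]; apply: Pc; rewrite as_.
have [bc|cb'] := leP b c.
  by move=> t /andP[at_ tb]; apply: Pc'; rewrite at_ (le_trans tb).
have /near_at_rightP[d d0 Hd] := Pr c (introT andP (conj ac cb')) Pcc.
pose e := Num.min (c + d / 2) b.
have ce : c < e by rewrite lt_min cb' andbT; lra.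
suff : A e by move=> /(sup_upper_bound supA); rewrite leNgt ce.
split; first by rewrite (le_trans ac (ltW ce)) ge_min lexx orbT.
move=> s /andP[as_ se]; have [sc|cs] := leP s c; first by apply: Pc'; rewrite as_.
apply: Hd; rewrite cs/= (le_lt_trans se)// gt_min; apply/orP; left; lra.
Qed.

(** The derivative bound is asked for only while [z <= zeta]. The strict gap between [z a] and
    [zeta] leaves room for a slightly increasing barrier that stays below [zeta], so the bound never
    ceases to be available. *)
Lemma dini_nonincreasing (R : realType) (a b : R) (z : R -> R) (S : seq R)
    (zeta : R) :
  a <= b -> z a < zeta ->
  (forall t, a <= t < b -> z t <= zeta -> t \notin S -> forall e, 0 < e ->
     \forall s \near t^'+, z s <= z t + e * (s - t)) ->
  (forall t, a <= t < b -> t \in S -> forall e, 0 < e ->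
     \forall s \near t^'+, z s <= z t + e) ->
  (forall t, a < t <= b -> forall e, 0 < e ->
     \forall s \near t^'-, z t <= z s + e) ->
  z b <= z a.
Proof.
move=> ab zaz Hg Hr Hl.
suff H e : 0 < e -> e * ((b - a) + (size S)%:R) < zeta - z a ->
    z b <= z a + e * ((b - a) + (size S)%:R).
  set k := (b - a) + (size S)%:R in H.
  have k0 : 0 <= k by rewrite addr_ge0// subr_ge0.
  apply/ler_addgt0Pr => e e0.
  (* The total slack has to stay below both the wanted error [e] and the gap [zeta - z a]. Dividing
     by [k + 1] instead of [k] allows [k = 0]. *)
  pose e1 := Num.min e ((zeta - z a) / 2).
  have e10 : 0 < e1 by rewrite lt_min e0/=; lra.
  have e1k : e1 / (k + 1) * k <= e1.
    by rewrite mulrAC ler_pdivrMr ?ltr_wpDl// ler_wpM2l ?ltW//; lra.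
  apply: (le_trans (H (e1 / (k + 1)) _ _)).
  - by rewrite divr_gt0// ltr_wpDl.
  - apply: (le_lt_trans e1k); rewrite gt_min; apply/orP; right; lra.
  - by rewrite lerD2l (le_trans e1k)// ge_min lexx.
move=> e0 esmall.
(* Every exceptional instant already passed grants an extra slack [e]. *)
pose W t := z a + e * ((t - a) + (count (< t) S)%:R).
have Wle s t (m k : nat) : s <= t -> (m <= k)%N ->
    z a + e * ((s - a) + m%:R) <= z a + e * ((t - a) + k%:R).
  move=> st mk; rewrite lerD2l; apply: ler_wpM2l; first exact: ltW.
  by apply: lerD; rewrite ?lerD2r// ler_nat.
have cmono s t : s <= t -> (count (< s) S <= count (< t) S)%N.
  by move=> st; apply: sub_count => x /=  /lt_le_trans; exact.
have Wmono s t : s <= t -> W s <= W t by move=> st; exact/Wle/cmono.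
have Wz t : t <= b -> W t < zeta.
  move=> tb; apply: (@le_lt_trans _ _ (z a + e * (b - a + (size S)%:R))).
    by apply: Wle => //; exact: count_size.
  by rewrite addrC -ltrBrDr.
suff : z b <= W b.
  by move=> /le_trans; apply; apply: Wle => //; exact: count_size.
apply: (@real_induction _ a b (fun t => z t <= W t)) => //; last by rewrite lexx ab.
- by rewrite /W subrr add0r lerDl mulr_ge0// ltW.
- move=> t atb ztW.
  have ztz : z t <= zeta by apply/ltW/(le_lt_trans ztW)/Wz/ltW; case/andP: atb.
  have [tS|tS] := boolP (t \in S); last first.
    have /near_at_rightP[d d0 Hd] := Hg t atb ztz tS e e0.
    apply/near_at_rightP; exists d => // s tsd; apply: (le_trans (Hd s tsd)).
    have ts : t <= s by apply/ltW; case/andP: tsd.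
    have := Wle s s _ _ (lexx s) (cmono _ _ ts); rewrite -/(W s).
    by move=> /(le_trans _); apply; move: ztW; rewrite /W; nra.
  have /near_at_rightP[d d0 Hd] := Hr t atb tS e e0.
  apply/near_at_rightP; exists d => // s tsd; apply: (le_trans (Hd s tsd)).
  have /andP[ts _] := tsd.
  have cS : (count (< t)%R S < count (< s)%R S)%N.
    rewrite -(addn1 (count _ _)).
    have -> : count (< s)%R S =
        (count (< t)%R S + count (fun x => (t <= x < s)%R) S)%N.
      rewrite -count_predUI -[LHS]addn0; congr addn.
        apply: eq_count => x /=; case: (ltP x t) => //= xt.
        by rewrite (lt_trans xt ts).
      rewrite -(count_pred0 S); apply: eq_count => x /=.
      by case: (ltP x t).
    by rewrite leq_add2l -has_count; apply/hasP; exists t; rewrite //= lexx ts.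
  apply: (@le_trans _ _ (z a + e * ((t - a) + (count (< t)%R S).+1%:R))).
    by move: ztW; rewrite /W -[in X in _ -> X]addn1 natrD; nra.
  by apply: Wle => //; exact: ltW.
- move=> t atb H; apply/ler_addgt0Pr => e1 e10.
  have /near_at_leftP[d d0 Hd] := Hl t atb e1 e10.
  have /andP[at_ tb] := atb.
  pose s := Num.max a (t - d / 2).
  have st : s < t by rewrite gt_max at_/=; lra.
  have as_ : a <= s by rewrite le_max lexx.
  apply: (le_trans (Hd s _)).
    rewrite st andbT lt_max; apply/orP; right; lra.
  rewrite lerD2r; apply: (le_trans (H s _)); first by rewrite as_ st.
  by apply: Wmono; exact: ltW.
Qed.

(** * Norms on column vectors *)

Section norms.
Context {R : realType} {n : nat} {N : 'cV[R]_n -> R}.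
Hypothesis NN : is_norm N.

Lemma is_norm0 : N 0 = 0.
Proof. by have [_ NZ _] := NN; rewrite -(scale0r 0) NZ normr0 mul0r. Qed.

Lemma is_normN x : N (- x) = N x.
Proof. by have [_ NZ _] := NN; rewrite -scaleN1r NZ normrN1 mul1r. Qed.

Lemma is_norm_ge0 x : 0 <= N x.
Proof.
have [ND _ _] := NN; have := ND x (- x).
by rewrite subrr is_norm0 is_normN -mulr2n pmulrn_lge0.
Qed.

Lemma is_normC x y : N (x - y) = N (y - x).
Proof. by rewrite -is_normN opprB. Qed.

Lemma is_norm_le_dist x y : N x <= N y + N (x - y).
Proof. by have [ND _ _] := NN; have := ND y (x - y); rewrite addrC subrK. Qed.

Lemma mx_entry_le_norm m p (x : 'M[R]_(m, p)) i j : `|x i j| <= `|x|.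
Proof.
rewrite [leRHS]/Num.norm /= mx_normrE.
exact: (le_bigmax _ (fun ij : 'I_m * 'I_p => `|x ij.1 ij.2|) (i, j)).
Qed.

Lemma is_norm_le_mx_norm : exists2 K, 0 < K & forall x, N x <= K * `|x|.
Proof.
have [ND NZ _] := NN.
(* The summand 1 keeps the constant positive when [n = 0]. *)
exists (\sum_i N (delta_mx i ord0) + 1).
  by rewrite ltr_wpDl// sumr_ge0// => i _; exact: is_norm_ge0.
move=> x; rewrite {1}(matrix_sum_delta x).
apply: (@le_trans _ _ (\sum_i N (x i ord0 *: delta_mx i ord0))).
  under eq_bigr do rewrite big_ord1.
  elim/big_ind2 : _ => [|a b c d ab cd|//]; first by rewrite is_norm0.
  by apply: (le_trans (ND _ _)); exact: lerD.
rewrite mulrDl mul1r -[leLHS]addr0 lerD// mulr_suml ler_sum// => i _.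
by rewrite NZ mulrC ler_wpM2l ?is_norm_ge0// mx_entry_le_norm.
Qed.

Lemma mx_norm_trmx p q (x : 'M[R]_(p, q)) : `|x^T| = `|x|.
Proof.
suff H p' q' (y : 'M[R]_(p', q')) : `|y^T| <= `|y|.
  by apply/eqP; rewrite eq_le H/= -{1}(trmxK x) H.
rewrite [leLHS]/Num.norm /= mx_normrE; apply/bigmax_leP; split => // i _.
by rewrite mxE mx_entry_le_norm.
Qed.

Lemma is_norm_trmx_continuous : continuous (fun x : 'rV[R]_n => N x^T).
Proof.
have [K K0 NK] := is_norm_le_mx_norm.
move=> x; apply/(@cvgrPdist_le _ _ _ _ (nbhs_filter x)) => e e_gt0.
apply: (iffRL (nbhs_ballP _ _)); exists (e / K); first exact: divr_gt0.
rewrite mx_norm_ball => y /= yx; apply: (@le_trans _ _ (N (x - y)^T)).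
  rewrite ler_norml; apply/andP; split.
    by rewrite lerNl opprB lerBlDr addrC linearB/= is_normC is_norm_le_dist.
  by rewrite lerBlDr addrC linearB/= is_norm_le_dist.
by apply: (le_trans (NK _)); rewrite mx_norm_trmx mulrC -ler_pdivlMr//; exact: ltW.
Qed.

(** The continuous function [N] has a positive minimum on the compact unit sphere, and its inverse
    is the constant. Transposes appear because the compactness and extreme value theorems used here
    are stated for row vectors. *)
Lemma mx_norm_le_is_norm : exists2 K, 0 < K & forall x, `|x| <= K * N x.
Proof.
have [ND NZ N0] := NN; have [K K0 NK] := is_norm_le_mx_norm.
(* In the trivial space the sphere is empty and has no minimum. *)
have [n0|[e0 e0N]] : (forall x : 'cV[R]_n, x = 0) \/ exists e : 'cV[R]_n, `|e| = 1.
  case: (pselect (exists x : 'cV[R]_n, x != 0)) => [[x x0]|H]; last first.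
    by left=> x; apply/eqP/negPn/negP => xn0; apply: H; exists x.
  by right; exists (`|x|^-1 *: x); rewrite normrZ normfV normr_id mulVf// normr_eq0.
  by exists 1 => // x; rewrite (n0 x) normr0 is_norm0 mulr0.
pose A : set 'rV[R]_n := [set x | `|x| = 1].
have trN p q (x : 'M[R]_(p, q)) : `|x^T| = `|x| by exact: mx_norm_trmx.
have cN := is_norm_trmx_continuous.
have cA : compact A.
  apply: bounded_closed_compact.
    exists 1; split => // M M1 x /= ->; exact: ltW.
  have -> : A = Num.norm @^-1` [set 1] by [].
  by apply: closed_comp => [x _|]; [exact: norm_continuous|exact: closed_eq].
have A0 : A !=set0 by exists e0^T; rewrite /A/= trN.
have [c cA1 cmin] := EVT_min_rV A0 cA (continuous_subspaceT cN).
have Nc : 0 < N c^T.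
  rewrite lt_neqAle is_norm_ge0 andbT eq_sym; apply/eqP => /N0 c0.
  by move: cA1; rewrite inE /A/= -trN c0 normr0 => /esym/eqP; rewrite oner_eq0.
exists (N c^T)^-1; first by rewrite invr_gt0.
move=> x; have [->|x0] := eqVneq x 0; first by rewrite normr0 is_norm0 mulr0.
have x0' : 0 < `|x| by rewrite normr_gt0.
have /cmin : (`|x|^-1 *: x)^T \in A.
  by rewrite inE /A/= trN normrZ normfV normr_id mulVf// gt_eqF.
rewrite trmxK NZ normfV normr_id ler_pdivlMl// => ?.
by rewrite ler_pdivlMl// mulrC.
Qed.

(* Only increments anchored at one end are needed, so that the radius on which
   the estimate holds may depend on the anchor. *)
Lemma pointwise_lipschitz_le (F : R -> 'cV[R]_n) (a b L : R) :
  a <= b ->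
  (forall s, a <= s <= b -> exists2 d, 0 < d &
     forall s', a <= s' <= b -> `|s' - s| < d ->
       N (F s' - F s) <= L * `|s' - s|) ->
  N (F b - F a) <= L * (b - a).
Proof.
move=> ab H; have [ND _ _] := NN.
suff : N (F b - F a) - L * (b - a) <= N (F a - F a) - L * (a - a).
  by rewrite subrr is_norm0 subrr mulr0 subr0 subr_le0.
have incr t s : N (F s - F a) <= N (F t - F a) + N (F s - F t).
  apply: (le_trans _ (ND _ _)); rewrite le_eqVlt; apply/orP; left.
  by apply/eqP; congr N; rewrite [RHS]addrC addrA subrK.
pose z s := N (F s - F a) - L * (s - a).
apply: (@dini_nonincreasing _ a b z [::] (z a + 1)) => //; first by rewrite ltrDl.
- move=> t /andP[at_ tb] _ _ e e0; apply/near_at_rightP.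
  have [|d d0 Hd] := H t; first by rewrite at_ ltW.
  exists (Num.min d (b - t)); first by rewrite lt_min d0 subr_gt0.
  move=> s /andP[ts]; rewrite addr_minr lt_min => /andP[sd sb].
  have st0 : 0 < s - t by rewrite subr_gt0.
  have sab : a <= s <= b by apply/andP; split; lra.
  have := Hd s sab; rewrite (gtr0_norm st0) => /(_ ltac:(lra)) Ns.
  have := incr t s; have := mulr_gt0 e0 st0.
  rewrite /z; lra.
- move=> t /andP[at_ tb] e e0; apply/near_at_leftP.
  have [|d d0 Hd] := H t; first by rewrite tb ltW.
  exists (Num.min d (t - a)); first by rewrite lt_min d0 subr_gt0.
  move=> s /andP[+ st].
  rewrite oppr_min addr_maxr gt_max => /andP[sd sa].
  have st0 : 0 < t - s by rewrite subr_gt0.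
  have sab : a <= s <= b by apply/andP; split; lra.
  have := Hd s sab; rewrite distrC (gtr0_norm st0) => /(_ ltac:(lra)) Ns.
  have := incr s t; rewrite is_normC in Ns.
  rewrite /z; lra.
Qed.

End norms.

Lemma mx_norm_is_norm {R : realType} {n : nat} :
  is_norm (fun x : 'cV[R]_n => `|x|).
Proof.
split; [exact: ler_normD|by move=> a x; exact: normrZ|].
by move=> x /eqP; rewrite normr_eq0 => /eqP.
Qed.

(** * Completed Lebesgue measure and majorants of integrable functions *)

Section completed_lebesgue.
Context {R : realType}.
Notation lm := (@completed_lebesgue_measure R).
Local Open Scope ereal_scope.

Lemma borel_lebesgue_measurable (A : set R) :
  measurable (A : set (measurableTypeR R)) -> measurable (A : set (lebesgueR R)).
Proof. exact: sub_caratheodory. Qed.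

Lemma lebesgueR_measurable_itv (i : interval R) :
  measurable ([set` i] : set (lebesgueR R)).
Proof. by apply: borel_lebesgue_measurable; exact: measurable_itv. Qed.

Lemma completed_lebesgue_measure_oc (a b : R) : (a <= b)%R -> lm `]a, b] = (b - a)%:E.
Proof.
move=> ab; rewrite -[LHS]/(lebesgue_measure `]a, b]%classic).
rewrite lebesgue_measure_itv/= lte_fin; case: ltP => // ba.
by have /eqP -> : a == b; rewrite ?subrr// eq_le ab ba.
Qed.

Lemma completed_lebesgue_measure_cc (a b : R) : (a <= b)%R -> lm `[a, b] = (b - a)%:E.
Proof.
move=> ab; rewrite -[LHS]/(lebesgue_measure `[a, b]%classic).
rewrite lebesgue_measure_itv/= lte_fin; case: ltP => // ba.
by have /eqP -> : a == b; rewrite ?subrr// eq_le ab ba.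
Qed.

Lemma lebesgue_open_superset (A : set R) (e : R) : (0 < e)%R ->
  exists U : set R, [/\ open U, A `<=` U & lm U <= lm A + e%:E].
Proof. exact: outer_measure_open_le. Qed.

(* The majorant is [U t = \sum_k (k + 1) d |V_k `&` ]a, t]|], where the open sets
   [V_k] contain the level sets [[k d <= p < (k + 1) d]] with little excess. *)
Lemma ge0_increasing_majorant (p : R -> R) (a b e : R) :
  (a <= b)%R -> (0 < e)%R -> (forall t, (0 <= p t)%R) ->
  lebesgue_integrable `[a, b] p ->
  exists U : R -> R, [/\ (U a = 0)%R,
    (forall s t, a <= s -> s <= t -> t <= b -> U s <= U t)%R,
    (U b <= lebesgue_int a b p + e)%R &
    forall t, (a <= t < b)%R ->
      \forall s \near t^'+, (p t * (s - t) <= U s - U t)%R].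
Proof.
move=> ab e0 p0 ip.
have mab : measurable (`[a, b]%classic : set (lebesgueR R)).
  exact: lebesgueR_measurable_itv.
have mp : measurable_fun (`[a, b]%classic : set (lebesgueR R)) p.
  by move/measurable_int : ip => /measurable_EFinP.
(* Rounding [p] up to a multiple of [d] costs at most [d * (b - a) <= e / 2]; the [+ 1] covers
   [a = b]. *)
pose d := (e / 2 / (b - a + 1))%R.
have ba1 : (0 < b - a + 1)%R by lra.
have d0 : (0 < d)%R by rewrite !divr_gt0.
pose E k : set (lebesgueR R) :=
  `[a, b]%classic `&` [set t | (k%:R * d <= p t < k.+1%:R * d)%R].
have mE k : measurable (E k).
  have -> : E k = `[a, b]%classic `&` p @^-1` `[(k%:R * d)%R, (k.+1%:R * d)%R[%classic.
    by rewrite /E; congr (_ `&` _); apply/seteqP; split=> x /=; rewrite in_itv.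
  exact: mp.
pose w k : R := (k.+1%:R * d)%R.
have w0 k : (0 < w k)%R by rewrite mulr_gt0.
(* Weighted by [w k], the excess of [V k] over [E k] is at most [e / 2 / 2 ^ k.+1]; these sum to the
   other half of [e]. *)
have ek k : (0 < e / 2 / (2 ^ k.+1)%:R / w k)%R.
  by rewrite !divr_gt0// ltr0n expn_gt0.
have /choice[V HV] k := lebesgue_open_superset (E k) _ (ek k).
have mV k : measurable (V k : set (lebesgueR R)).
  by apply: borel_lebesgue_measurable; apply: open_measurable; case: (HV k).
pose S t := \sum_(0 <= k <oo) (w k)%:E * lm (V k `&` `]a, t]).
have mVI k s t : measurable (V k `&` `]s, t] : set (lebesgueR R)).
  by apply: measurableI => //; exact: lebesgueR_measurable_itv.
have term_ge0 k A : 0 <= (w k)%:E * lm A.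
  by rewrite mule_ge0// lee_fin ltW.
have Sadd s t : (a <= s)%R -> (s <= t)%R ->
    S t = S s + \sum_(0 <= k <oo) (w k)%:E * lm (V k `&` `]s, t]).
  move=> as_ st; rewrite -nneseriesD//; apply: eq_eseriesr => k _.
  rewrite -ge0_muleDr//; congr (_ * _).
  have -> : V k `&` `]a, t] = (V k `&` `]a, s]) `|` (V k `&` `]s, t]).
    rewrite -setIUr; congr (_ `&` _); apply/seteqP; split => x /=; rewrite !in_itv/=.
      by move=> /andP[ax xt]; case: (leP x s) => xs; [left|right]; rewrite ?ax ?xs.
    move=> [/andP[ax xs]|/andP[sx xt]]; first by rewrite ax (le_trans xs).
    by rewrite (le_lt_trans as_ sx) xt.
  rewrite measureU; [by []|exact: mVI|exact: mVI|].
  apply/seteqP; split => // x [[_ xs] [_ sx]].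
  have /andP[_ {}xs] : (a < x <= s)%R by [].
  by have /andP[] : (s < x <= t)%R by []; rewrite ltNge xs.
have intp : (lebesgue_int a b p)%:E = \int[lm]_(t in `[a, b]) (p t)%:E.
  by rewrite /lebesgue_int /Rintegral fineK//; exact: integrable_fin_num ip.
have Ecover : `[a, b]%classic = \bigcup_k E k.
  apply/seteqP; split => [x xab|x [k _ []//]].
  have pd : (0 <= p x / d)%R by rewrite divr_ge0// ltW.
  exists (Num.truncn (p x / d)) => //; split => //=.
  by rewrite -ler_pdivlMr// -ltr_pdivrMr// truncn_itv.
have Etriv : trivIset setT E.
  apply/trivIsetP => i j _ _; wlog ij : i j / (i < j)%N.
    move=> H; rewrite neq_ltn => /orP[ij|ji]; first by apply: H => //; rewrite ltn_eqF.
    by rewrite setIC; apply: H => //; rewrite ltn_eqF.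
  move=> _; apply/seteqP; split => // x [[_ /= /andP[_ xi]] [_ /= /andP[jx _]]].
  have : (i.+1%:R * d <= j%:R * d)%R by rewrite ler_pM2r// ler_nat.
  by move=> /(lt_le_trans xi)/lt_le_trans-/(_ _ jx); rewrite ltxx.
have sumE : \sum_(0 <= k <oo) lm (E k) = (b - a)%:E.
  rewrite -completed_lebesgue_measure_cc// {1}Ecover.
  by rewrite measure_bigcup//; apply: eq_eseriesl => k; rewrite in_setT.
have iE : \int[lm]_(t in `[a, b]) (p t)%:E = \sum_(0 <= k <oo) \int[lm]_(t in E k) (p t)%:E.
  rewrite {1}Ecover ge0_integral_bigcup// -?Ecover; first exact/measurable_EFinP.
  by move=> x _; rewrite lee_fin.
have Sb : S b <= (lebesgue_int a b p + e)%:E.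
  apply: (@le_trans _ _ (\sum_(0 <= k <oo)
      ((\int[lm]_(t in E k) (p t)%:E + d%:E * lm (E k)) +
       (e / 2 / (2 ^ k.+1)%:R)%:E))).
    apply: lee_nneseries => [k _ _|k _]; first exact: term_ge0.
    have [_ EV lmV] := HV k.
    apply: (@le_trans _ _ ((w k)%:E * (lm (E k) + (e / 2 / (2 ^ k.+1)%:R / w k)%:E))).
      rewrite lee_pmul2l ?lte_fin//; apply: le_trans lmV.
      by rewrite le_measure ?inE//; exact: subIsetl.
    rewrite ge0_muleDr; [|exact: measure_ge0|by rewrite lee_fin ltW].
    rewrite -EFinM mulrCA mulfV ?gt_eqF// mulr1 leeD2r//.
    rewrite {1}/w -natr1 mulrDl mul1r EFinD ge0_muleDl; last 2 first.
    - by rewrite lee_fin mulr_ge0// ltW.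
    - by rewrite lee_fin ltW.
    rewrite leeD2r// -integral_cst//; apply: ge0_le_integral => //.
    - by move=> x _; rewrite lee_fin mulr_ge0// ltW.
    - apply/measurable_EFinP; apply: measurable_funS mp => //; exact: subIsetl.
    - by move=> x [_ /= /andP[+ _]]; rewrite lee_fin.
  apply: (le_trans (epsilon_trick _ _ _)).
  - move=> k; rewrite adde_ge0//; first by apply: integral_ge0 => x _; rewrite lee_fin.
    by rewrite mule_ge0// lee_fin ltW.
  - by rewrite divr_ge0// ltW.
  rewrite nneseriesD; last 2 first.
  - by move=> k _ _; apply: integral_ge0 => x _; rewrite lee_fin.
  - by move=> k _ _; rewrite mule_ge0// lee_fin ltW.
  rewrite -iE nneseriesZl// sumE -intp -EFinM -!EFinD lee_fin -addrA lerD2l.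
  have : (d * (b - a) <= e / 2)%R.
    rewrite /d mulrAC ler_pdivrMr// ler_wpM2l ?divr_ge0 ?ltW//; lra.
  lra.
have S0 t : 0 <= S t by apply: nneseries_ge0 => k _ _; exact: term_ge0.
have Smono s t : (a <= s)%R -> (s <= t)%R -> S s <= S t.
  move=> as_ st; rewrite (Sadd s t)// leeDl//; apply: nneseries_ge0 => k _ _.
  exact: term_ge0.
have Sfin t : (a <= t <= b)%R -> S t \is a fin_num.
  move=> /andP[at_ tb]; rewrite ge0_fin_numE//.
  apply: le_lt_trans (Smono _ _ at_ tb) _.
  by apply: (le_lt_trans Sb); rewrite ltry.
exists (fine \o S); split => /=.
- rewrite /S eseries0// => k _ _.
  have -> : V k `&` `]a, a] = set0 :> set R by rewrite set_itvxx setI0.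
  by rewrite measure0 mule0.
- move=> s t as_ st tb; rewrite fine_le ?Sfin ?Smono//.
    by rewrite as_ (le_trans st).
  by rewrite (le_trans as_ st) tb.
- by rewrite -lee_fin fineK// Sfin// lexx ab.
move=> t /andP[at_ tb].
have : (\bigcup_k E k) t by rewrite -Ecover /= in_itv/= at_ ltW.
(* The open set [V k] contains []t, s]] for [s] close to [t], so the [k]-th term alone grows by
   [w k * (s - t)], and [w k] exceeds [p t]. The other terms do not decrease. *)
move=> [k _ Ekt]; have [oV EV _] := HV k.
have : nbhs t (V k) by apply: open_nbhs_nbhs; split => //; exact: EV.
move=> /nbhs_ballP[r /= r0 rV].
apply/near_at_rightP; exists (Num.min r (b - t))%R; first by rewrite lt_min r0 subr_gt0.
move=> s /andP[ts]; rewrite addr_minr lt_min => /andP[sr sb].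
have atb : (a <= t <= b)%R by rewrite at_ ltW.
have asb : (a <= s <= b)%R by apply/andP; split; lra.
rewrite -lee_fin.
have -> : (((fine \o S) s - (fine \o S) t)%R%:E =
    \sum_(0 <= k <oo) (w k)%:E * lm (V k `&` `]t, s])).
  rewrite /= EFinB (fineK (Sfin _ asb)) (fineK (Sfin _ atb)).
  by rewrite (Sadd t s at_ (ltW ts)) addeAC subee ?Sfin// add0e.
have st0 : (0 <= s - t)%R by rewrite subr_ge0 ltW.
apply: (@le_trans _ _ ((w k)%:E * lm (V k `&` `]t, s]))).
  have -> : V k `&` `]t, s] = `]t, s]%classic.
    apply/setIidPr => x /=; rewrite in_itv/= => /andP[tx xs]; apply: rV.
    by rewrite /ball/= ltr_norml; apply/andP; split; lra.
  rewrite (completed_lebesgue_measure_oc _ _ (ltW ts)) -EFinM lee_fin ler_wpM2r//.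
  by case: Ekt => _ /= /andP[_ /ltW].
rewrite (@nneseriesD1 _ _ k)//; by rewrite leeDl//; apply: nneseries_ge0.
Qed.
End completed_lebesgue.

Section lebesgue_int.
Context {R : realType}.
Notation lm := (@completed_lebesgue_measure R).

Lemma lebesgue_integrable_sub (a b c d : R) (g : R -> R) :
  a <= c -> d <= b -> lebesgue_integrable `[a, b] g -> lebesgue_integrable `[c, d] g.
Proof.
move=> ac db; apply: integrableS; try exact: lebesgueR_measurable_itv.
by move=> x /=; rewrite !in_itv/= => /andP[cx xd]; rewrite (le_trans ac cx) (le_trans xd db).
Qed.

Lemma lebesgue_integrable_cst (a b k : R) : lebesgue_integrable `[a, b] (fun=> k).
Proof.
have mab := @lebesgueR_measurable_itv R `[a, b].
apply/integrableP; split; first exact/measurable_EFinP.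
rewrite integral_cst//; have [ab|ba] := leP a b.
  by rewrite /= completed_lebesgue_measure_cc// -EFinM ltry.
by rewrite set_itv_ge ?bnd_simp -?ltNge// measure0 mule0 ltry.
Qed.

Lemma lebesgue_integrableD (a b : R) (g h : R -> R) :
  lebesgue_integrable `[a, b] g -> lebesgue_integrable `[a, b] h ->
  lebesgue_integrable `[a, b] (fun t => g t + h t).
Proof.
exact: (integrableD (lebesgueR_measurable_itv `[a, b])).
Qed.

Lemma lebesgue_intD (a b : R) (g h : R -> R) :
  lebesgue_integrable `[a, b] g -> lebesgue_integrable `[a, b] h ->
  lebesgue_int a b (fun t => g t + h t) = lebesgue_int a b g + lebesgue_int a b h.
Proof.
by move=> ig ih; apply: RintegralD => //; exact: lebesgueR_measurable_itv.
Qed.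

Lemma lebesgue_int_cst (a b k : R) : a <= b ->
  lebesgue_int a b (fun=> k) = k * (b - a).
Proof.
move=> ab; rewrite /lebesgue_int Rintegral_cst; last exact: lebesgueR_measurable_itv.
by rewrite /= completed_lebesgue_measure_cc.
Qed.

Lemma lebesgue_int_split (a s t : R) (g : R -> R) : a <= s -> s <= t ->
  lebesgue_integrable `[a, t] g ->
  lebesgue_int a t g = lebesgue_int a s g + \int[lm]_(x in `]s, t]) g x.
Proof.
move=> as_ st ig.
have E : `[a, t]%classic = `[a, s]%classic `|` `]s, t]%classic.
  rewrite -itv_bndbnd_setU// bnd_simp//.
rewrite {1}/lebesgue_int E Rintegral_setU//.
- exact: lebesgueR_measurable_itv.
- exact: lebesgueR_measurable_itv.
- by rewrite -E.
apply/disj_setPS => x /= [].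
by rewrite !in_itv/= => /andP[_ xs] /andP[]; rewrite ltNge xs.
Qed.

Lemma lebesgue_integrable_oc (a s t : R) (g : R -> R) : a <= s ->
  lebesgue_integrable `[a, t] g -> lm.-integrable `]s, t] (EFin \o g).
Proof.
move=> as_; apply: integrableS; try exact: lebesgueR_measurable_itv.
by move=> x /=; rewrite !in_itv/= => /andP[cx ->]; rewrite (le_trans as_ (ltW cx)).
Qed.

(** Absolute continuity of the integral, applied to [g] extended by zero outside [[a, b]]. *)
Lemma lebesgue_int_uniform_continuous (a b e : R) (g : R -> R) : 0 < e ->
  lebesgue_integrable `[a, b] g ->
  exists2 d, 0 < d & forall s t, a <= s -> s <= t -> t <= b -> t - s < d ->
    `|lebesgue_int a t g - lebesgue_int a s g| < e.
Proof.
move=> e0 ig; have mab := @lebesgueR_measurable_itv R `[a, b].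
have ig' : lm.-integrable setT (EFin \o (g \_ `[a, b])).
  by rewrite -restrict_EFin; apply/integrable_restrict => //=; rewrite setTI.
have [d [d0 Hd]] := integral_normr_continuous ig' e0.
exists d => // s t as_ st tb tsd.
have igat : lebesgue_integrable `[a, t] g by exact: lebesgue_integrable_sub ig.
have igst := lebesgue_integrable_oc _ _ _ _ as_ igat.
have mst := @lebesgueR_measurable_itv R `]s, t].
rewrite (lebesgue_int_split _ _ _ _ as_ st)// addrC addKr.
apply: (le_lt_trans (le_normr_Rintegral mst igst)).
apply: le_lt_trans (Hd `]s, t]%classic mst _); last first.
  by rewrite /= completed_lebesgue_measure_oc.
rewrite le_eqVlt; apply/orP; left; apply/eqP; apply: eq_Rintegral => x.
rewrite inE /= in_itv/= => /andP[sx xt].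
by rewrite patchE mem_set//= in_itv/= (le_trans as_ (ltW sx)) (le_trans xt tb).
Qed.

Lemma lebesgue_int_right_derivative (a b t e : R) (g : R -> R) : 0 < e ->
  a <= t < b -> lebesgue_integrable `[a, b] g -> g s @[s --> t^'+] --> g t ->
  \forall s \near t^'+,
    `|lebesgue_int a s g - lebesgue_int a t g - g t * (s - t)| <= e * (s - t).
Proof.
move=> e0 /andP[at_ tb] ig /cvgrPdist_le /(_ e e0) /near_at_rightP[d d0 Hd].
apply/near_at_rightP; exists (Num.min d (b - t)); first by rewrite lt_min d0 subr_gt0.
move=> s /andP[ts]; rewrite addr_minr lt_min => /andP[sd sb].
have sb' : s <= b by lra.
have igas : lebesgue_integrable `[a, s] g by exact: lebesgue_integrable_sub ig.
have igst := lebesgue_integrable_oc _ _ _ _ at_ igas.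
have mts := @lebesgueR_measurable_itv R `]t, s].
have cE k : \int[lm]_(x in `]t, s]) k = k * (s - t).
  by rewrite Rintegral_cst//= completed_lebesgue_measure_oc// ltW.
have icst k : lm.-integrable `]t, s] (EFin \o (fun=> k)).
  exact: lebesgue_integrable_oc at_ (lebesgue_integrable_cst _ _ _).
rewrite (lebesgue_int_split _ _ _ _ at_ (ltW ts) igas) [_ + _ - lebesgue_int _ _ _]addrC addKr.
rewrite -(cE (g t)) -RintegralB// -(cE e).
have iB : lm.-integrable `]t, s] (EFin \o (fun x => g x - g t)).
  exact: (integrableB mts igst (icst _)).
apply: (le_trans (le_normr_Rintegral mts iB)).
apply: le_Rintegral => //; first exact: (integrable_norm iB).
move=> x; rewrite /= in_itv/= => /andP[tx xs]; rewrite distrC; apply: Hd.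
by rewrite tx (le_lt_trans xs sd).
Qed.

(* Vitali-Carathéodory: the indefinite integral of [g] has right derivative [g]
   only almost everywhere, whereas [U] dominates [g] at every instant. *)
Lemma increasing_majorant (g : R -> R) (a b e : R) : a <= b -> 0 < e ->
  lebesgue_integrable `[a, b] g ->
  exists (M : R) (U : R -> R), [/\ 0 <= M, U a = 0,
    forall s t, a <= s -> s <= t -> t <= b -> U s - M * (t - s) <= U t,
    U b <= lebesgue_int a b g + e &
    forall t, a <= t < b ->
      \forall s \near t^'+, g t * (s - t) <= U s - U t].
Proof.
move=> ab e0 ig; have mab := @lebesgueR_measurable_itv R `[a, b].
have e20 : 0 < e / 2 by lra.
have mg : measurable_fun (`[a, b]%classic : set (lebesgueR R)) g.
  by move/measurable_int : ig => /measurable_EFinP.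
(* Truncation from below makes [G k + k] nonnegative, and dominated convergence makes its effect on
   the integral smaller than [e / 2] for some [k]. *)
pose G (k : nat) t := Num.max (g t) (- k%:R).
have mG k : measurable_fun (`[a, b]%classic : set (lebesgueR R)) (G k).
  exact: measurable_maxr.
have ign : lm.-integrable `[a, b] (EFin \o (fun x => `|g x|)).
  exact: integrable_norm.
have Gg k x : `|G k x| <= `|g x|.
  rewrite /G; case: (leP (g x) (- k%:R)) => // gk.
  by rewrite !ler0_norm ?lerN2// (le_trans gk)// lerNl oppr0.
have iG k : lebesgue_integrable `[a, b] (G k).
  apply: (le_integrable mab _ _ ign); first exact/measurable_EFinP.
  by move=> x _; rewrite /= lee_fin normr_id.
have [_ _ /fine_cvgP[_]] : [/\ lm.-integrable `[a, b] (EFin \o g),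
    [sequence (\int[lm]_(x in `[a, b]) `|(G n x)%:E - (g x)%:E|)%E]_n @ \oo --> 0%E &
    [sequence (\int[lm]_(x in `[a, b]) (G n x)%:E)%E]_n @ \oo -->
      ((lebesgue_int a b g)%:E)].
  rewrite /lebesgue_int /Rintegral fineK; last exact: integrable_fin_num.
  apply: (@dominated_convergence _ _ _ lm _ mab (fun n => EFin \o G n)
    (EFin \o g) (EFin \o (fun x => `|g x|))) => //.
  - by move=> k; exact/measurable_EFinP.
  - exact/measurable_EFinP.
  - apply: aeW => x _; apply: cvg_near_cst.
    exists (Num.truncn `|g x|).+1 => // k /= xk; rewrite /G max_l//.
    rewrite lerNl (le_trans (ler_norm _))// normrN ltW//.
    by rewrite (lt_le_trans (truncnS_gt _))// ler_nat.
  - by apply: aeW => x k _; rewrite /= lee_fin.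
move=> /cvgrPdist_lt/(_ _ e20)[k _ /(_ k (leqnn k))].
move=> Hk0.
have Hk : `|lebesgue_int a b g - lebesgue_int a b (G k)| < e / 2 by [].
have Gk0 t : 0 <= G k t + k%:R by rewrite -lerBlDr sub0r le_max lexx orbT.
have iGk := lebesgue_integrableD _ _ _ _ (iG k) (lebesgue_integrable_cst a b k%:R).
have [U [Ua Umono Ub Ug]] := ge0_increasing_majorant _ _ _ _ ab e20 Gk0 iGk.
(* Undoing the shift by [k] costs monotonicity: the majorant may now decrease, but at rate at most
   [M = k]. *)
exists k%:R, (fun t => U t - k%:R * (t - a)); split => //.
- by rewrite Ua subrr mulr0 subr0.
- move=> s t as_ st tb; have := Umono s t as_ st tb; lra.
- move: Ub; rewrite lebesgue_intD//; last exact: lebesgue_integrable_cst.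
  rewrite lebesgue_int_cst//; move: Hk; rewrite ltr_norml => /andP[Hk1 Hk2]; lra.
- move=> t atb; have [d d0 Hd] := (near_at_rightP _ _ _).1 (Ug t atb).
  apply/near_at_rightP; exists d => // s tsd; have := Hd s tsd.
  have /andP[ts _] := tsd; have : g t <= G k t by rewrite le_max lexx.
  nra.
Qed.

End lebesgue_int.

(** * A Gronwall inequality with jumps *)

Section jump_sum.
Context {R : realType}.
Implicit Types (tt beta : nat -> R) (a t : R).

(** Closed at [t], hence right-continuous like the switched norm, which at [tt j] already has its
    value after the jump; open at [a] for the same reason. The cutoff [m] is meant to exceed the
    index of every jump up to the final time. *)
Definition jump_sum tt beta (m : nat) a t : R :=
  \sum_(j < m | a < tt j <= t) ln (beta j).

Lemma jump_sum_bound tt beta m a t :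
  `|jump_sum tt beta m a t| <= \sum_(j < m) `|ln (beta j)|.
Proof.
apply: (le_trans (ler_norm_sum _ _ _)); rewrite big_mkcond; apply: ler_sum => j _.
by case: ifP.
Qed.

Lemma jump_sum_refl tt beta m a : jump_sum tt beta m a a = 0.
Proof. by rewrite /jump_sum big_pred0// => j; case: ltP. Qed.

Lemma jump_sum_near_right tt beta m a t :
  \forall s \near t^'+, jump_sum tt beta m a s = jump_sum tt beta m a t.
Proof.
have : \forall s \near t^'+, forall j : 'I_m, (tt j <= s) = (tt j <= t).
  apply: filter_forall => j; apply/near_at_rightP.
  have [jt|tj] := leP (tt j) t.
    by exists 1 => // s /andP[ts _]; rewrite (le_trans jt (ltW ts)).
  exists (tt j - t); first by rewrite subr_gt0.
  by move=> s; rewrite addrC subrK => /andP[_ sj]; rewrite leNgt sj.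
by apply: filterS => s Hs; apply: eq_bigl => j; rewrite Hs.
Qed.

Lemma jump_sum_near_left tt beta m a t :
  \forall s \near t^'-,
    jump_sum tt beta m a s = \sum_(j < m | a < tt j < t) ln (beta j).
Proof.
have : \forall s \near t^'-, forall j : 'I_m, (tt j <= s) = (tt j < t).
  apply: filter_forall => j; apply/near_at_leftP.
  have [jt|tj] := ltP (tt j) t.
    exists (t - tt j); first by rewrite subr_gt0.
    by move=> s; rewrite subKr => /andP[js _]; rewrite ltW.
  by exists 1 => // s /andP[_ st]; rewrite leNgt (lt_le_trans st tj).
by apply: filterS => s Hs; apply: eq_bigl => j; rewrite Hs.
Qed.

Lemma jump_sumE tt beta m a t : (forall j, t <> tt j) ->
  jump_sum tt beta m a t = \sum_(j < m | a < tt j < t) ln (beta j).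
Proof.
move=> tj; apply: eq_bigl => j; rewrite (le_eqVlt (tt j)).
by have /negbTE -> : tt j != t by apply/eqP => jt; exact: (tj j).
Qed.

Lemma jump_sum_jump tt beta m a j : injective tt -> (j < m)%N -> a < tt j ->
  jump_sum tt beta m a (tt j) =
  ln (beta j) + \sum_(i < m | a < tt i < tt j) ln (beta i).
Proof.
move=> tt_inj jm aj; rewrite /jump_sum (bigD1 (Ordinal jm))/= ?lexx ?aj//.
congr (_ + _); apply: eq_bigl => i.
rewrite [(tt i < tt j)%O]lt_neqAle (inj_eq tt_inj) -val_eqE/= -andbA.
by congr (_ && _); rewrite andbC.
Qed.

End jump_sum.

(* The constant [E] does not depend on [v], so that the smallness requirement
   [E * v a < zeta] can be met by shrinking [v a]. *)
Lemma gronwall_jump {R : realType} (g : R -> R) (tt beta : nat -> R) (a b e : R)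
    (m : nat) :
  a <= b -> 0 < e -> lebesgue_integrable `[a, b] g ->
  (forall j, tt j <= b -> (j < m)%N) -> injective tt -> (forall j, 0 < beta j) ->
  exists2 E, 0 < E & forall (v : R -> R) (zeta : R),
    (forall t, a <= t <= b -> 0 <= v t) ->
    (forall t, a <= t < b -> v t <= zeta -> (forall j, t <> tt j) ->
       forall e', 0 < e' -> \forall s \near t^'+,
         v s <= v t * (1 + (g t + e') * (s - t)) + e' * (s - t)) ->
    (forall j, a <= tt j < b -> forall e', 0 < e' ->
       \forall s \near (tt j)^'+, v s <= v (tt j) + e') ->
    (forall t, a < t <= b -> (forall j, t <> tt j) -> v s @[s --> t^'-] --> v t) ->
    (forall j, a < tt j <= b ->
       exists2 l : R, v s @[s --> (tt j)^'-] --> l & v (tt j) <= beta j * l) ->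
    E * v a < zeta ->
    v b <= expR (lebesgue_int a b g + jump_sum tt beta m a b + e) * v a.
Proof.
move=> ab e0 ig ttm tt_inj beta0.
(* Raising the rate by [e1] makes room for the error in the Dini bound, at a cost of at most
   [e / 2]; the majorant uses the other half. *)
pose e1 := e / 2 / (b - a + 1).
have ba1 : 0 < b - a + 1 by lra.
have e10 : 0 < e1 by rewrite !divr_gt0.
have e20 : 0 < e / 2 by lra.
have icst := lebesgue_integrable_cst a b e1.
have [M [U [M0 Ua Umono Ub Ug]]] :=
  increasing_majorant _ _ _ _ ab e20 (lebesgue_integrableD _ _ _ _ ig icst).
rewrite lebesgue_intD// lebesgue_int_cst// in Ub.
have {}Ub : U b <= lebesgue_int a b g + e.
  have : e1 * (b - a) <= e / 2.
    rewrite /e1 mulrAC ler_pdivrMr// ler_pM2l//; lra.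
  lra.
pose G t := jump_sum tt beta m a t.
pose B := \sum_(j < m) `|ln (beta j)|.
have GB t : - B <= G t <= B by rewrite -ler_norml jump_sum_bound.
pose K := expR (M * (b - a) + B).
have Mab t : a <= t <= b -> 0 <= M * (t - a) <= M * (b - a).
  by move=> /andP[at_ tb]; rewrite mulr_ge0 ?subr_ge0//= ler_wpM2l// lerD2r.
have UK t : a <= t <= b -> expR (- (U t + G t)) <= K.
  move=> tab; rewrite ler_expR; have /andP[at_ tb] := tab.
  have := Umono _ _ (lexx a) at_ tb; have /andP[_ ?] := Mab _ tab.
  have /andP[? _] := GB t; lra.
(* This bounds [expR (U t + G t)] on [[a, b]], because [U t <= U b + M * (b - t)]. Hence
   [v <= E * z] for the quotient [z] below, and the threshold [zeta] for [v] becomes [zeta / E] for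
   [z]. *)
exists (expR (U b + M * (b - a) + B)); first exact: expR_gt0.
move=> v zeta v0 vg vr vl vj small.
set E := expR _ in small; have E0 : 0 < E by exact: expR_gt0.
(* Dividing [v] by its expected growth reduces the claim to [z b <= z a]. *)
pose z t := v t * expR (- (U t + G t)).
have vz t : v t = z t * expR (U t + G t).
  by rewrite -mulrA -expRD addNr expR0 mulr1.
have z0 t : a <= t <= b -> 0 <= z t by move=> /v0 vt; rewrite mulr_ge0 ?expR_ge0.
have za : z a = v a by rewrite /z Ua /G jump_sum_refl addr0 oppr0 expR0 mulr1.
have K0 : 0 < K := expR_gt0 _.
suff zba : z b <= z a.
  rewrite vz mulrC -za; apply: ler_pM; rewrite ?expR_ge0 ?z0 ?ab ?lexx//.
  by rewrite ler_expR; rewrite -/(G b); lra.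
have zzeta t : a <= t <= b -> z t <= zeta / E -> v t <= zeta.
  move=> tab zt; rewrite vz -(divfK (lt0r_neq0 E0) zeta) ler_pM ?z0 ?expR_ge0//.
  rewrite ler_expR; have /andP[at_ tb] := tab.
  have := Umono _ _ at_ tb (lexx b); have := Mab _ tab => /andP[? ?].
  have /andP[_ ?] := GB t.
  have : M * (b - t) <= M * (b - a) by rewrite ler_wpM2l// lerD2l lerN2.
  lra.
have tab_of t : a <= t < b -> a <= t <= b by move=> /andP[-> /ltW].
pose S := [seq tt j | j <- iota 0 m].
have notinS t : t < b -> t \notin S -> forall j, t <> tt j.
  move=> tb tS j tj; move/negP : tS; apply; apply/mapP; exists j => //.
  by rewrite mem_iota/= ttm// -tj ltW.
apply: (@dini_nonincreasing _ a b z S (zeta / E)) => //.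
- by rewrite za ltr_pdivlMr// mulrC.
- move=> t tab /(zzeta _ (tab_of _ tab)) vt tS e' e'0.
  have /andP[at_ tb] := tab; have tj := notinS _ tb tS.
  (* The bound [d <= e1] lets the majorant absorb the error in the rate; [d * K <= e'] controls the
     additive error after multiplication by the exponential, which is at most [K]. *)
  pose d := Num.min e1 (e' / K).
  have d0 : 0 < d by rewrite lt_min e10 divr_gt0.
  have de1 : d <= e1 by rewrite ge_min lexx.
  have dK : d * K <= e' by rewrite -ler_pdivlMr// ge_min lexx orbT.
  have vt0 : 0 <= v t by apply: v0; exact: tab_of.
  near=> s.
  have ts : t < s by near: s; exact: nbhs_right_gt.
  have sb : s < b by near: s; exact: nbhs_right_lt.
  have Us : (g t + e1) * (s - t) <= U s - U t by near: s; exact: Ug.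
  have Gs : G s = G t by near: s; exact: jump_sum_near_right.
  have vs : v s <= v t * (1 + (g t + d) * (s - t)) + d * (s - t).
    by near: s; exact: vg.
  have sab : a <= s <= b by rewrite (ltW sb) andbT (le_trans at_ (ltW ts)).
  have st0 : 0 < s - t by rewrite subr_gt0.
  have vs' : v s <= v t * expR (U s - U t) + d * (s - t).
    apply: (le_trans vs); rewrite lerD2r ler_wpM2l//.
    apply: le_trans (expR_ge1Dx _); rewrite lerD2l; apply: le_trans Us.
    by rewrite ler_pM2r// lerD2l.
  apply: (@le_trans _ _ ((v t * expR (U s - U t) + d * (s - t)) * expR (- (U s + G s)))).
    by rewrite ler_wpM2r ?expR_ge0.
  rewrite mulrDl -mulrA -expRD Gs.
  have -> : U s - U t + - (U s + G t) = - (U t + G t) by ring.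
  rewrite lerD2l mulrAC ler_pM2r//; apply: le_trans dK.
  by rewrite ler_pM2l// -Gs UK.
- move=> t tab tS e' e'0; have /andP[at_ tb] := tab.
  have /mapP[j _ tj] := tS.
  pose d := e' / 2 / K; have d0 : 0 < d by rewrite !divr_gt0.
  (* [U] need not be continuous, but an upward jump of [U] only lowers [z], and a decrease at rate
     at most [M] raises [z] by a factor of at most [expR (M * (s - t))], which tends to 1. *)
  have : z t * expR (M * (s - t)) @[s --> t^'+] --> z t * expR (M * (t - t)).
    apply: cvgMr; apply: cvg_at_right_filter; apply: continuous_cvg.
      exact: continuous_expR.
    by apply: cvgMr; apply: cvgB; [exact: cvg_id|exact: cvg_cst].
  rewrite subrr mulr0 expR0 mulr1 => /cvgrPdist_le/(_ (e' / 2)) zM.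
  near=> s.
  have ts : t < s by near: s; exact: nbhs_right_gt.
  have sb : s < b by near: s; exact: nbhs_right_lt.
  have Gs : G s = G t by near: s; exact: jump_sum_near_right.
  have vs : v s <= v t + d.
    by near: s; rewrite tj; apply: vr => //; rewrite -tj.
  have sab : a <= s <= b by rewrite (ltW sb) andbT (le_trans at_ (ltW ts)).
  have zMs : `|z t - z t * expR (M * (s - t))| <= e' / 2.
    by near: s; apply: zM; rewrite divr_gt0.
  apply: (@le_trans _ _ ((v t + d) * expR (- (U s + G s)))).
    by rewrite ler_wpM2r ?expR_ge0.
  rewrite mulrDl [e']splitr addrA lerD//; last first.
    by rewrite -[leRHS](divfK (lt0r_neq0 K0)) ler_pM2l// UK.
  apply: (@le_trans _ _ (z t * expR (M * (s - t)))).
    rewrite -mulrA -expRD ler_wpM2l ?v0 ?tab_of// ler_expR Gs.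
    have := Umono _ _ at_ (ltW ts) (ltW sb); lra.
  by move: zMs; rewrite ler_norml => /andP[? _]; lra.
- move=> t tab e' e'0; have /andP[at_ tb] := tab.
  pose H := \sum_(i < m | a < tt i < t) ln (beta i).
  (* At [tt j] the new term [ln (beta j)] in [G] cancels the factor [beta j] gained by [v], so only
     the jump sum [H] from before [t] remains. *)
  have [l vtl zt] : exists2 l : R, v s @[s --> t^'-] --> l &
      z t <= l * expR (- (U t + H)).
    have [[j tj]|nj] := pselect (exists j, t = tt j); last first.
      have tj j : t <> tt j by move=> tj; apply: nj; exists j.
      by exists (v t); [exact: vl|rewrite /z /G jump_sumE].
    have [|l vl' vtl] := vj j; first by rewrite -tj.
    exists l; first by rewrite tj.
    rewrite /z tj /G jump_sum_jump ?ttm -?tj//.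
    rewrite -/H (addrC (ln _)) addrA opprD expRD [X in _ * (_ * X)]expRN.
    rewrite lnK ?posrE// mulrA ler_pdivrMr// mulrAC ler_wpM2r ?expR_ge0//.
    by rewrite mulrC tj.
  have l0 : 0 <= l.
    apply: (cvgr_to_ge vtl); near=> s; apply: v0; apply/andP; split.
      by near: s; exact: nbhs_left_ge.
    by apply: le_trans tb; near: s; exact: nbhs_left_le.
  pose d := e' / K; have d0 : 0 < d by rewrite divr_gt0.
  have : l * expR (M * (t - s)) - v s @[s --> t^'-] --> l * expR (M * (t - t)) - l.
    apply: cvgB => //; apply: cvgMr; apply: cvg_at_left_filter; apply: continuous_cvg.
      exact: continuous_expR.
    by apply: cvgMr; apply: cvgB; [exact: cvg_cst|exact: cvg_id].
  rewrite subrr mulr0 expR0 mulr1 subrr => /cvgrPdist_le/(_ d d0) lM.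
  near=> s.
  have st : s < t by near: s; exact: nbhs_left_lt.
  have as_ : a < s by near: s; exact: nbhs_left_gt.
  have Gs : G s = H by near: s; exact: jump_sum_near_left.
  have lMs : `|0 - (l * expR (M * (t - s)) - v s)| <= d by near: s.
  have sab : a <= s <= b by rewrite (ltW as_) (le_trans (ltW st) tb).
  apply: (le_trans zt).
  apply: (@le_trans _ _ (l * expR (M * (t - s)) * expR (- (U s + G s)))).
    rewrite -mulrA -expRD ler_wpM2l// ler_expR Gs.
    have := Umono _ _ (ltW as_) (ltW st) tb; lra.
  rewrite -lerBlDl -mulrBl -[leRHS](divfK (lt0r_neq0 K0)) -/d.
  have ld : l * expR (M * (t - s)) - v s <= d.
    by move: lMs; rewrite sub0r normrN ler_norml => /andP[].
  apply: (@le_trans _ _ (d * expR (- (U s + G s)))).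
    by rewrite ler_wpM2r ?expR_ge0.
  by rewrite ler_pM2l// UK.
Unshelve. all: by end_near. Qed.

(** * Strict differentiability on a reachable set *)

Section increments.
Context {R : realType}.

Lemma differentiable_increment (V W : normedModType R) (f : V -> W) (x : V) (e : R) :
  differentiable f x -> 0 < e ->
  exists2 d, 0 < d & forall y, `|y - x| < d ->
    `|f y - f x - 'd f x (y - x)| <= e * `|y - x|.
Proof.
move=> /diff_locally/eqaddoP df e0.
have /nbhs_normP[d /= d0 H] := df e e0; exists d => // y yx.
have := H (y - x); rewrite /= sub0r normrN => /(_ yx).
by rewrite /= !fctE /= subrK opprD addrA.
Qed.

Lemma derivable_increment (W : normedModType R) (g : R -> W) (s e : R) :
  derivable g s 1 -> 0 < e ->
  exists2 d, 0 < d & forall t, `|t - s| < d ->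
    `|g t - g s - (t - s) *: derive1 g s| <= e * `|t - s|.
Proof.
move=> dg e0; have /derivable1_diffP dg' := dg.
have [d d0 H] := differentiable_increment _ _ _ _ _ dg' e0.
by exists d => // t /H; rewrite deriv1E.
Qed.

Lemma mulmx_norm_le (m n p : nat) (A : 'M[R]_(m, n)) (B : 'M[R]_(n, p)) :
  `|A *m B| <= n%:R * `|A| * `|B|.
Proof.
rewrite [leLHS]/Num.norm /= mx_normrE; apply/bigmax_leP; split => [|i _].
  by rewrite !mulr_ge0.
rewrite mxE; apply: (le_trans (ler_norm_sum _ _ _)).
rewrite -mulrA mulr_natl -[X in _ *+ X]card_ord -sumr_const ler_sum// => j _.
by rewrite normrM ler_pM// mx_entry_le_norm.
Qed.

Lemma jacobian_mxE (n : nat) (g : 'cV[R]_n -> 'cV[R]_n) (x v : 'cV[R]_n) :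
  jacobian_mx g x *m v = 'd g x v.
Proof.
apply/colP => i; rewrite {2}(matrix_sum_delta v).
under eq_bigr do rewrite big_ord1.
rewrite linear_sum/= summxE mxE; apply: eq_bigr => j _.
by rewrite linearZ/= !mxE mulrC.
Qed.

Lemma within_prod_continuous_dist (U V : normedModType R) (C : set U)
    (F : U * R -> V) (p : U) (u : R) (e : R) :
  {within C `*` setT, continuous F} -> C p -> 0 < e ->
  exists2 d, 0 < d & forall q w, C q -> `|q - p| < d -> `|w - u| < d ->
    `|F (q, w) - F (p, u)| < e.
Proof.
move=> /subspace_continuousP/(_ (p, u) (conj _ I)) cF Cp e0.
have /cvgrPdist_lt/(_ e e0) := cF Cp.
rewrite near_withinE => /nbhs_normP[d /= d0 H]; exists d => // q w Cq qp wu.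
rewrite distrC; apply: H => //=.
by rewrite prod_normE/= gt_max; apply/andP; split; rewrite distrC.
Qed.

(** The strict inequality leaves a margin for the remainder, which is small in the entrywise norm
    and hence in [N]. *)
Lemma is_norm_derivable_local {n : nat} {N : 'cV[R]_n -> R} (NN : is_norm N)
    (g : R -> 'cV[R]_n) (s L : R) :
  derivable g s 1 -> N (derive1 g s) < L ->
  exists2 d, 0 < d & forall t, `|t - s| < d -> N (g t - g s) <= L * `|t - s|.
Proof.
have [_ NZ _] := NN; have [K K0 NK] := is_norm_le_mx_norm NN.
move=> dg gL.
have e0 : 0 < (L - N (derive1 g s)) / K by rewrite divr_gt0// subr_gt0.
have [d d0 H] := derivable_increment _ _ _ _ dg e0.
exists d => // t /H; rewrite mulrAC ler_pdivlMr// => {}H.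
apply: (le_trans (is_norm_le_dist NN _ ((t - s) *: derive1 g s))).
have := NK (g t - g s - (t - s) *: derive1 g s); rewrite NZ; lra.
Qed.

Context {n : nat} {N : 'cV[R]_n -> R}.
Hypothesis NN : is_norm N.

(** [C] need not be convex, so the mean value argument follows a curve in [C] instead of a segment.
    Its speed is at most a multiple of [|y - x|], which keeps it where the Jacobian varies little.
    Joint continuity of the Jacobian makes the radius uniform for [u] near [u0], as a switching
    signal requires. *)
Lemma reachable_strictly_differentiable (C : set 'cV[R]_n)
    (f : 'cV[R]_n -> R -> 'cV[R]_n) (p : 'cV[R]_n) (u0 e : R) :
  kappa_reachable N C ->
  (forall x u, C x -> differentiable (f ^~ u) x) ->
  {within C `*` setT,
     continuous (fun p : 'cV[R]_n * R => jacobian_mx (f ^~ p.2) p.1)} ->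
  C p -> 0 < e ->
  exists2 d, 0 < d & forall x y u, C x -> C y ->
    `|x - p| < d -> `|y - p| < d -> `|u - u0| < d ->
    `|f y u - f x u - jacobian_mx (f ^~ u) x *m (y - x)| <= e * `|y - x|.
Proof.
move=> [kappa kappa0 reach] fd Jc Cp e0.
have [K1 K10 NK] := is_norm_le_mx_norm NN.
have [K2 K20 KN] := mx_norm_le_is_norm NN.
(* Up to the [+ 1], which gives strictness, [k * |y - x|] bounds the speed of the curve in the
   entrywise norm. *)
pose k := K2 * (kappa * K1) + 1.
have k0 : 0 < k by rewrite ltr_wpDl// !mulr_ge0// ltW.
(* The Jacobian varies by at most [2 * e1] along the curve, and a matrix product costs a factor [n]:
   this contributes [e / (2 * k)], half of what the speed bound allows. Using [n.+1] avoids division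
   by zero. *)
pose e1 := e / (4 * k * n.+1%:R).
have e10 : 0 < e1 by rewrite !(divr_gt0, mulr_gt0).
have [d0 d00 Hd0] := within_prod_continuous_dist _ _ _ _ p u0 _ Jc Cp e10.
(* Points of the curve lie within [k * |y - x| + |x - p| < k * (2 * d) + d = d0] of [p]. *)
pose d := d0 / (2 * k + 1).
have d_gt0 : 0 < d by rewrite divr_gt0// addr_gt0// mulr_gt0.
have dd0 : d * (2 * k + 1) = d0 by rewrite divfK// lt0r_neq0// addr_gt0// mulr_gt0.
have dled0 : d <= d0 by rewrite -dd0 ler_peMr ?(ltW d_gt0)// lerDr mulr_ge0// ltW.
exists d => // x y u Cx Cy xp yp uu0.
have [->|xy] := eqVneq y x; first by rewrite !subrr mulmx0 subr0 !normr0 mulr0.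
have yx0 : 0 < `|y - x| by rewrite normr_gt0 subr_eq0.
have yx2 : `|y - x| <= 2 * d.
  have -> : y - x = (y - p) - (x - p) by rewrite opprB addrA subrK.
  by apply: (le_trans (ler_normB _ _)); lra.
have [gam [[gam0 gam1] Cgam dgam _ gamN]] := reach _ _ Cx Cy.
have gamL s : 0 <= s <= 1 -> exists2 d', 0 < d' & forall t, `|t - s| < d' ->
    `|gam t - gam s| <= k * `|y - x| * `|t - s|.
  move=> s01; have s01' : s \in `[0, 1] by rewrite in_itv.
  have gs : `|derive1 gam s| < k * `|y - x|.
    apply: (le_lt_trans (KN _)).
    apply: (@le_lt_trans _ _ (K2 * (kappa * K1) * `|y - x|)); last first.
      by rewrite ltr_pM2r// /k ltrDl.
    rewrite -!mulrA ler_pM2l//; apply: (le_trans (gamN _ s01')).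
    by rewrite ler_pM2l// distrC.
  exact: (is_norm_derivable_local (@mx_norm_is_norm R n) _ _ _ (dgam _ s01') gs).
have gamx s : 0 <= s <= 1 -> `|gam s - x| <= k * `|y - x|.
  move=> /andP[s0 s1]; rewrite -{1}gam0.
  apply: (@le_trans _ _ (k * `|y - x| * (s - 0))); last first.
    by rewrite subr0 ler_piMr// mulr_ge0// ltW.
  apply: (pointwise_lipschitz_le (@mx_norm_is_norm R n) gam 0 s) => // r /andP[r0 rs].
  have [|d' d'0 H] := gamL r; first by rewrite r0 (le_trans rs).
  by exists d' => // s' _; exact: H.
pose J z := jacobian_mx (f ^~ u) z.
have Jclose z : C z -> `|z - p| < d0 -> `|J z - J x| <= 2 * e1.
  move=> Cz zp; have uu : `|u - u0| < d0 by exact: lt_le_trans dled0.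
  have H1 : `|J z - jacobian_mx (f ^~ u0) p| < e1 := Hd0 z u Cz zp uu.
  have H2 : `|J x - jacobian_mx (f ^~ u0) p| < e1 :=
    Hd0 x u Cx (lt_le_trans xp dled0) uu.
  move: (J z) (J x) (jacobian_mx _ p) H1 H2 => A B A0 H1 H2.
  have -> : A - B = (A - A0) - (B - A0) by rewrite opprB addrA subrK.
  by apply: (le_trans (ler_normB _ _)); lra.
(* The quantity to bound is the increment of [g] over [[0, 1]], so a pointwise Lipschitz estimate
   for [g] suffices. *)
pose g s := f (gam s) u - J x *m gam s.
have -> : f y u - f x u - jacobian_mx (f ^~ u) x *m (y - x) = g 1 - g 0.
  rewrite /g gam0 gam1 mulmxBr !opprB addrA addrAC.
  by rewrite -!addrA; congr (_ + _); rewrite addrCA; congr (_ + _); rewrite addrC.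
apply: (@le_trans _ _ (e * `|y - x| * (1 - 0))); last by rewrite subr0 mulr1.
apply: (pointwise_lipschitz_le (@mx_norm_is_norm R n) g 0 1) => // s s01.
have s01' : s \in `[0, 1] by rewrite in_itv.
have [d1 d10 H1] := gamL s s01.
have e20 : 0 < e / (2 * k) by rewrite divr_gt0// mulr_gt0.
have Cs := Cgam _ s01'.
have [d2 d20 H2] := differentiable_increment _ _ _ _ _ (fd _ u Cs) e20.
have ky0 : 0 < k * `|y - x| by rewrite mulr_gt0.
exists (Num.min d1 (d2 / (k * `|y - x|))); first by rewrite lt_min d10 divr_gt0.
move=> t t01; rewrite lt_min => /andP[td1]; rewrite ltr_pdivlMr// mulrC => td2.
have gts := H1 t td1.
have {}H2 := H2 _ (le_lt_trans gts td2).
have -> : g t - g s = (f (gam t) u - f (gam s) u - 'd (f ^~ u) (gam s) (gam t - gam s))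
    + (J (gam s) - J x) *m (gam t - gam s).
  rewrite -jacobian_mxE -/(J _) mulmxBl addrA subrK /g mulmxBr !opprB.
  by rewrite addrA addrAC -!addrA; congr (_ + _); rewrite addrCA; congr (_ + _); rewrite addrC.
apply: (le_trans (ler_normD _ _)).
have sp : `|gam s - p| < d0.
  have -> : gam s - p = (gam s - x) + (x - p) by rewrite addrA subrK.
  apply: (le_lt_trans (ler_normD _ _)); have := gamx s s01.
  have : k * `|y - x| <= k * (2 * d) by rewrite ler_pM2l.
  by rewrite -dd0; lra.
have H3 : `|(J (gam s) - J x) *m (gam t - gam s)| <= e / (2 * k) * `|gam t - gam s|.
  apply: (le_trans (mulmx_norm_le _ _ _ _ _)); rewrite ler_wpM2r//.
  apply: (@le_trans _ _ (n.+1%:R * (2 * e1))).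
    by apply: ler_pM => //; [rewrite ler_nat|exact: Jclose].
  by rewrite /e1 le_eqVlt; apply/orP; left; apply/eqP; field; rewrite lt0r_neq0//= pnatr_eq0.
apply: (le_trans (lerD H2 H3)); rewrite -mulrDl.
have -> : e / (2 * k) + e / (2 * k) = e / k by field; rewrite lt0r_neq0.
have -> : e * `|y - x| * `|t - s| = e / k * (k * `|y - x| * `|t - s|).
  by rewrite !mulrA divfK// lt0r_neq0.
by rewrite ler_wpM2l// divr_ge0// ltW.
Qed.

End increments.

(** * Regularity along solutions *)

Section piecewise.
Context {R : realType} {S : topologicalType} {g : R -> S}.
Hypothesis gpc : piecewise_continuous g.

Lemma piecewise_continuous_right t : 0 <= t -> g s @[s --> t^'+] --> g t.
Proof.
move=> t0; have [d [_ _ cg dg]] := gpc.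
have [[i ->]|nd] := pselect (exists i, t = d i); first by have [] := dg i.
have td i : t <> d i by move=> ti; apply: nd; exists i.
apply: cvg_trans (cg t t0 td); apply: cvg_app => A /=.
apply: (@filterS _ (nbhs t)) => s H ts; apply: H.
by rewrite /= in_itv/= andbT ltW// (le_lt_trans t0 ts).
Qed.

Lemma piecewise_continuous_left t : 0 < t -> exists l : S, g s @[s --> t^'-] --> l.
Proof.
move=> t0; have [d [_ _ cg dg]] := gpc.
have [[i ->]|nd] := pselect (exists i, t = d i); first by have [] := dg i.
have td i : t <> d i by move=> ti; apply: nd; exists i.
exists (g t); apply: cvg_trans (cg t (ltW t0) td); apply: cvg_app => A /= H; near=> s.
have s0 : 0 <= s by near: s; exact: nbhs_left_ge.
have : `[0, +oo[%classic s -> A s by near: s; exact: cvg_at_left_filter H.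
by apply; rewrite /= in_itv/= s0.
Unshelve. all: by end_near. Qed.

End piecewise.

Lemma mx_norm_le_entries {R : realType} {m n : nat} (v : 'M[R]_(m, n)) (e : R) :
  0 <= e -> (forall i j, `|v i j| <= e) -> `|v| <= e.
Proof.
move=> e0 H; rewrite [leLHS]/Num.norm /= mx_normrE.
by apply/bigmax_leP; split => // i _; exact: H.
Qed.

Section solution.
Context {R : realType} {n : nat} {C : set 'cV[R]_n} {r : R -> R}
  {f : 'cV[R]_n -> R -> 'cV[R]_n} {t0 : R} {x : R -> 'cV[R]_n}.
Hypothesis r_pwc : piecewise_continuous r.
Hypothesis f_cont : {within C `*` setT,
  continuous (fun p : 'cV[R]_n * R => f p.1 p.2)}.
Hypothesis t0_ge0 : 0 <= t0.
Hypothesis x_sol : caratheodory_solution f r t0 x.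
Hypothesis Cx : forall t, t0 <= t -> C (x t).

Lemma solution_increment s t (i : 'I_n) : t0 <= s -> t0 <= t ->
  (x t - x s) i ord0 = lebesgue_int t0 t (fun s => f (x s) (r s) i ord0) -
                       lebesgue_int t0 s (fun s => f (x s) (r s) i ord0).
Proof.
move=> ts0 tt0; rewrite !mxE.
have [_ ->] := x_sol t i tt0; have [_ ->] := x_sol s i ts0.
by rewrite opprD addrACA subrr add0r.
Qed.

Lemma solution_right_continuous t : t0 <= t -> x s @[s --> t^'+] --> x t.
Proof.
move=> tt0; apply/cvgrPdist_le => e e0.
have : \forall s \near t^'+, forall i : 'I_n, `|(x s - x t) i ord0| <= e.
  apply: filter_forall => i.
  have [|ig _] := x_sol (t + 1) i; first by rewrite ler_wpDr.
  have [d d0 H] := lebesgue_int_uniform_continuous _ _ _ _ e0 ig.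
  apply/near_at_rightP; exists (Num.min 1 d); first by rewrite lt_min ltr01.
  move=> s /andP[ts]; rewrite addr_minr lt_min => /andP[s1 sd].
  rewrite solution_increment ?(le_trans tt0 (ltW ts))//.
  by apply/ltW/H => //; [exact: ltW|exact: ltW|lra].
apply: filterS => s H; rewrite distrC; apply: mx_norm_le_entries; first exact: ltW.
by move=> i j; rewrite ord1.
Qed.

Lemma solution_left_continuous t : t0 < t -> x s @[s --> t^'-] --> x t.
Proof.
move=> tt0; apply/cvgrPdist_le => e e0.
have : \forall s \near t^'-, forall i : 'I_n, `|(x t - x s) i ord0| <= e.
  apply: filter_forall => i.
  have [ig _] := x_sol t i (ltW tt0).
  have [d d0 H] := lebesgue_int_uniform_continuous _ _ _ _ e0 ig.
  apply/near_at_leftP; exists (Num.min (t - t0) d); first by rewrite lt_min subr_gt0 tt0.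
  move=> s /andP[+ st]; rewrite oppr_min addr_maxr gt_max subKr => /andP[s0 sd].
  rewrite solution_increment ?(ltW s0) ?(ltW tt0)//.
  by apply/ltW/H => //; [exact: ltW|exact: ltW|lra].
apply: filterS => s H; apply: mx_norm_le_entries; first exact: ltW.
by move=> i j; rewrite ord1.
Qed.

Lemma vector_field_right_continuous t : t0 <= t ->
  f (x s) (r s) @[s --> t^'+] --> f (x t) (r t).
Proof.
move=> tt0; apply/cvgrPdist_le => e e0.
have [d d0 H] := within_prod_continuous_dist _ _ _ _ _ (r t) _ f_cont (Cx _ tt0) e0.
have rt := piecewise_continuous_right r_pwc t (le_trans t0_ge0 tt0).
have xt := solution_right_continuous _ tt0.
move/cvgrPdist_lt/(_ d d0) : rt => rt; move/cvgrPdist_lt/(_ d d0) : xt => xt.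
near=> s; rewrite distrC ltW//; apply: H.
- by apply/Cx/(le_trans tt0); near: s; exact: nbhs_right_ge.
- by rewrite distrC; near: s.
- by rewrite distrC; near: s.
Unshelve. all: by end_near. Qed.

(** A Carathéodory solution satisfies its equation almost everywhere in general. Here the signal is
    right-continuous, hence so is the integrand along [x], and the right derivative exists at every
    instant. *)
Lemma solution_right_derivative t e : t0 <= t -> 0 < e ->
  \forall s \near t^'+, `|x s - x t - (s - t) *: f (x t) (r t)| <= e * (s - t).
Proof.
move=> tt0 e0; have ft := vector_field_right_continuous _ tt0.
have : \forall s \near t^'+, forall i : 'I_n,
    `|(x s - x t - (s - t) *: f (x t) (r t)) i ord0| <= e * (s - t).
  apply: filter_forall => i.
  have [|ig _] := x_sol (t + 1) i; first by rewrite ler_wpDr.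
  have tt1 : t0 <= t < t + 1 by rewrite tt0 ltrDl ltr01.
  have fti : f (x s) (r s) i ord0 @[s --> t^'+] --> f (x t) (r t) i ord0.
    apply/cvgrPdist_le => e' e'0; move/cvgrPdist_le/(_ e' e'0) : ft.
    apply: filterS => s; apply: le_trans.
    have -> : f (x t) (r t) i ord0 - f (x s) (r s) i ord0 =
      (f (x t) (r t) - f (x s) (r s)) i ord0 by rewrite !mxE.
    exact: mx_entry_le_norm.
  have H := lebesgue_int_right_derivative _ _ _ _ _ e0 tt1 ig fti.
  near=> s; have ts : t <= s by near: s; exact: nbhs_right_ge.
  rewrite mxE solution_increment ?(le_trans tt0 ts)// !mxE mulrC.
  by near: s.
move=> H; near=> s; apply: mx_norm_le_entries.
  by rewrite mulr_ge0 ?(ltW e0)// subr_ge0; near: s; exact: nbhs_right_ge.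
by move=> i j; rewrite ord1; move: i; near: s.
Unshelve. all: by end_near. Qed.

(** Real induction on the final time replaces a compactness argument: the signal may jump, but it
    has one-sided limits, and near either of them a single radius works. *)
Lemma strict_differentiability_tube {N : 'cV[R]_n -> R} t1 e : is_norm N ->
  kappa_reachable N C ->
  (forall x u, C x -> differentiable (f ^~ u) x) ->
  {within C `*` setT,
     continuous (fun p : 'cV[R]_n * R => jacobian_mx (f ^~ p.2) p.1)} ->
  t0 <= t1 -> 0 < e ->
  exists2 d, 0 < d & forall t y, t0 <= t <= t1 -> C y -> `|y - x t| < d ->
    `|f y (r t) - f (x t) (r t) - jacobian_mx (f ^~ (r t)) (x t) *m (y - x t)|
      <= e * `|y - x t|.
Proof.
move=> NN Creach fd Jc t01 e0.
pose good d t := forall y, C y -> `|y - x t| < d ->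
    `|f y (r t) - f (x t) (r t) - jacobian_mx (f ^~ (r t)) (x t) *m (y - x t)|
      <= e * `|y - x t|.
have goodW d d' t : d' <= d -> good d t -> good d' t.
  by move=> dd' H y Cy yd; apply: H => //; exact: lt_le_trans dd'.
(* One radius serves all times of a one-sided punctured neighbourhood of [t],
   whatever the one-sided limit [u] of the signal. *)
have side (F : set_system R) (t u : R) : Filter F -> t0 <= t -> (\forall s \near F, t0 <= s) ->
    x s @[s --> F] --> x t -> r s @[s --> F] --> u ->
    exists2 d, 0 < d & \forall s \near F, good d s.
  move=> FF tt0 Ft0 xF rF.
  have [d d0 H] := reachable_strictly_differentiable NN C f _ u _ Creach fd Jc (Cx _ tt0) e0.
  have d20 : 0 < d / 2 by rewrite divr_gt0.
  exists (d / 2) => //.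
  move/cvgrPdist_lt/(_ (d / 2) d20) : xF => xF.
  move/cvgrPdist_lt/(_ d d0) : rF => rF.
  near=> s; have xs : `|x s - x t| < d / 2 by rewrite distrC; near: s.
  have ts : t0 <= s by near: s.
  move=> y Cy yx; apply: H => //.
  - exact: Cx.
  - by apply: (lt_trans xs); lra.
  - have -> : y - x t = (y - x s) + (x s - x t) by rewrite addrA subrK.
    by apply: (le_lt_trans (ler_normD _ _)); lra.
  - by rewrite distrC; near: s.
(* The instant [t] needs its own radius, since [r t] may differ from the left limit of [r]. *)
have point t : t0 <= t -> exists2 d, 0 < d & good d t.
  move=> tt0.
  have [d d0 H] := reachable_strictly_differentiable NN C f _ (r t) _ Creach fd Jc (Cx _ tt0) e0.
  by exists d => // y Cy yx; apply: H; rewrite ?subrr ?normr0//; exact: Cx.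
suff [d d0 H] : exists2 d, 0 < d & forall t, t0 <= t <= t1 -> good d t.
  by exists d => // t y t01'; exact: H.
apply: (@real_induction _ t0 t1
  (fun t' => exists2 d, 0 < d & forall t, t0 <= t <= t' -> good d t)) => //.
- have [d d0 H] := point t0 (lexx t0); exists d => // t t00.
  by have <- : t0 = t by apply/eqP; rewrite eq_le.
- move=> t /andP[tt0 tt1] [d d0 H].
  have ge_t0 : \forall s \near t^'+, t0 <= s.
    by near=> s; apply: (le_trans tt0); near: s; exact: nbhs_right_ge.
  have [d' d'0 H'] := side _ t (r t) (at_right_proper_filter t) tt0 ge_t0
    (solution_right_continuous _ tt0)
    (piecewise_continuous_right r_pwc t (le_trans t0_ge0 tt0)).
  have [c c0 Hc] := (near_at_rightP _ _ _).1 H'.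
  apply/near_at_rightP; exists c => // s /andP[ts sc].
  exists (Num.min d d'); first by rewrite lt_min d0.
  move=> t' /andP[t0t' t's]; have [t't|tt'] := leP t' t.
    by apply: (goodW d); [rewrite ge_min lexx|apply: H; rewrite t0t'].
  apply: (goodW d'); first by rewrite ge_min lexx orbT.
  by apply: Hc; rewrite tt' (le_lt_trans t's sc).
- move=> t /andP[tt0 tt1] H.
  have [u ru] := piecewise_continuous_left r_pwc t (le_lt_trans t0_ge0 tt0).
  have ge_t0 : \forall s \near t^'-, t0 <= s by exact: nbhs_left_ge.
  have [d' d'0 H'] := side _ t u (at_left_proper_filter t) (ltW tt0) ge_t0
    (solution_left_continuous _ tt0) ru.
  have [c c0 Hc] := (near_at_leftP _ _ _).1 H'.
  have [dt dt0 Ht] := point t (ltW tt0).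
  pose s := Num.max t0 (t - c / 2).
  have st : s < t by rewrite gt_max tt0/=; lra.
  have t0s : t0 <= s by rewrite le_max lexx.
  have [|d d0 Hd] := H s; first by rewrite t0s.
  exists (Num.min d (Num.min d' dt)); first by rewrite !lt_min d0 d'0.
  move=> t' /andP[t0t' t't]; have [t's|st'] := leP t' s.
    by apply: (goodW d); [rewrite ge_min lexx|apply: Hd; rewrite t0t'].
  move: t't; rewrite le_eqVlt => /predU1P[->|t't].
    by apply: (goodW dt) => //; rewrite !ge_min lexx !orbT.
  apply: (goodW d'); first by rewrite !ge_min lexx !orbT.
  apply: Hc; rewrite t't andbT (le_lt_trans _ st')// le_max; apply/orP; right; lra.
- by rewrite t01 lexx.
Unshelve. all: by end_near. Qed.

End solution.

(** * Contraction of the flow in the switched norm *)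

Section switched.
Context {R : realType} {n : nat} {I : Type} {N : I -> 'cV[R]_n -> R} {chi : R -> I}.
Hypothesis N_norm : forall k, is_norm (N k).

(** The limit superior is an infimum over neighbourhoods, so some right neighbourhood already has
    supremum below [a + e]; homogeneity passes from unit vectors to all vectors. *)
Lemma matrix_measure_growth t (A : 'M[R]_n) (a e : R) :
  (matrix_measure N chi t A <= a%:E)%E -> 0 < e ->
  \forall s \near t^'+, forall x,
    N (chi s) ((1%:M + (s - t) *: A) *m x) <= (1 + (a + e) * (s - t)) * N (chi t) x.
Proof.
move=> mA e0.
have /ereal_inf_lt[_ [V V0 <-] Va] : (matrix_measure N chi t A < (a + e)%:E)%E.
  by apply: (le_lt_trans mA); rewrite lte_fin ltrDl.
have /near_at_rightP[d d0 Hd] := V0.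
apply/near_at_rightP; exists d => // s /andP[ts sd] x.
have h0 : 0 < s - t by rewrite subr_gt0.
have Vh : V (s - t) by apply: Hd; rewrite h0 add0r; lra.
have := le_lt_trans (ereal_sup_ubound (ex_intro2 _ _ _ Vh erefl)) Va.
have tst : t + (s - t) = s by rewrite addrC subrK.
rewrite tst => /ltW; rewrite lee_pdivrMl// -EFinM => H.
have unit z : N (chi t) z = 1 ->
    N (chi s) ((1%:M + (s - t) *: A) *m z) <= 1 + (a + e) * (s - t).
  move=> z1; have := le_trans (ereal_sup_ubound (ex_intro2 _ _ _ z1 erefl)) H.
  by rewrite lee_fin lerBlDl mulrC.
have [ND NZ N0] := N_norm (chi t); have [_ NZs _] := N_norm (chi s).
have [/N0 ->|x0] := eqVneq (N (chi t) x) 0.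
  by rewrite mulmx0 !is_norm0// mulr0.
have Nx0 : 0 < N (chi t) x by rewrite lt_neqAle eq_sym x0 is_norm_ge0.
have /unit : N (chi t) ((N (chi t) x)^-1 *: x) = 1.
  by rewrite NZ ger0_norm ?invr_ge0 ?ltW// mulVf.
rewrite -scalemxAr NZs ger0_norm ?invr_ge0 ?(ltW Nx0)//.
by rewrite ler_pdivrMl// mulrC.
Qed.

(** The common bound [K] makes the norms equi-Lipschitz, so the moving argument [z s] may be
    replaced by its limit [w]. *)
Lemma switched_norm_cvg (F : set_system R) {FF : Filter F}
    (z : R -> 'cV[R]_n) (w : 'cV[R]_n) (K l : R) :
  0 < K -> (\forall s \near F, forall y, N (chi s) y <= K * `|y|) ->
  z s @[s --> F] --> w -> N (chi s) w @[s --> F] --> l ->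
  N (chi s) (z s) @[s --> F] --> l.
Proof.
move=> K0 NK zw Nl; apply/cvgrPdist_le => e e0.
have e20 : 0 < e / 2 by rewrite divr_gt0.
have e30 : 0 < e / 2 / K by rewrite divr_gt0.
move/cvgrPdist_le/(_ _ e20) : Nl => Nl; move/cvgrPdist_le/(_ _ e30) : zw => zw.
near=> s.
have H1 : forall y, N (chi s) y <= K * `|y| by near: s.
have H2 : `|l - N (chi s) w| <= e / 2 by near: s.
have H3 : `|w - z s| <= e / 2 / K by near: s.
have H4 : N (chi s) (w - z s) <= e / 2.
  by apply: (le_trans (H1 _)); rewrite mulrC -ler_pdivlMr.
have H5 := is_norm_le_dist (N_norm (chi s)) w (z s).
have H6 := is_norm_le_dist (N_norm (chi s)) (z s) w.
rewrite is_normC// in H6.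
move: H2; rewrite !ler_norml => /andP[? ?]; apply/andP; split; lra.
Unshelve. all: by end_near. Qed.

End switched.

(** If some instant exceeds [t], its index serves as [m]; otherwise infinitely many instants lie in
    [[0, t]]. *)
Lemma exists_jump_bound {R : realType} (tt : nat -> R) :
  (forall j, 0 < tt j) -> (forall i j, (i < j)%N -> tt i < tt j) ->
  (forall a b : R, finite_set [set j | a <= tt j <= b]) ->
  forall t, exists m, forall j, tt j <= t -> (j < m)%N.
Proof.
move=> tt0 ttS fin t; apply: contrapT => H.
have all j : tt j <= t.
  rewrite leNgt; apply/negP => tj; apply: H; exists j => i it.
  rewrite ltnNge; apply/negP; rewrite leq_eqVlt => /predU1P[ji|/ttS ji].
    by move: tj; rewrite ji ltNge it.
  by have := lt_le_trans (lt_trans tj ji) it; rewrite ltxx.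
have := fin 0 t; suff -> : [set j | 0 <= tt j <= t] = setT by exact: infinite_nat.
by apply/seteqP; split => // j _ /=; rewrite ltW// all.
Qed.

Lemma fsum_jumps {R : realType} (tt beta : nat -> R) m a b :
  (forall j, tt j <= b -> (j < m)%N) ->
  \sum_(j \in [set j | a < tt j < b]) ln (beta j) =
  \sum_(j < m | a < tt j < b) ln (beta j).
Proof.
move=> mb; rewrite -(big_mkord (fun j => a < tt j < b) (fun j => ln (beta j))).
rewrite /index_iota subn0 (@bigfs _ _ _ _ _ (fun j => a < tt j < b)) ?iota_uniq// => j /andP[_ jb].
by rewrite mem_iota/= mb ?ltW.
Qed.

Section flow.
Context {R : realType} {n : nat} {C : set 'cV[R]_n} {r : R -> R}
  {f : 'cV[R]_n -> R -> 'cV[R]_n} {I : Type} {N : I -> 'cV[R]_n -> R}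
  {chi : R -> I} {tt beta : nat -> R} {alpha : R -> R}.
Hypothesis r_pwc : piecewise_continuous r.
Hypothesis f_cont : {within C `*` setT,
  continuous (fun p : 'cV[R]_n * R => f p.1 p.2)}.
Hypothesis f_diff : forall x u, C x -> differentiable (f ^~ u) x.
Hypothesis df_cont : {within C `*` setT,
  continuous (fun p : 'cV[R]_n * R => jacobian_mx (f ^~ p.2) p.1)}.
Hypothesis N_norm : forall k, is_norm (N k).
Hypothesis tt_gt0 : forall j, 0 < tt j.
Hypothesis tt_incr : forall i j, (i < j)%N -> tt i < tt j.
Hypothesis N_right_cont : forall t, 0 <= t -> norm_right_continuous N chi t.
Hypothesis N_equiv : uniformly_equivalent N chi.
Hypothesis N_left_lim : forall j, norm_left_limit_exists N chi (tt j).
Hypothesis N_left_cont : forall t, 0 < t -> (forall j, t <> tt j) ->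
  norm_left_continuous N chi t.
Hypothesis C_reachable : forall t0, 0 <= t0 -> kappa_reachable (N (chi t0)) C.
Hypothesis beta_gt0 : forall j, 0 < beta j.
Hypothesis alpha_bound : forall t x, 0 <= t -> (forall j, t <> tt j) -> C x ->
  (matrix_measure N chi t (jacobian_mx (f ^~ (r t)) x) <= (alpha t)%:E)%E.
Hypothesis beta_bound : forall j x,
  N (chi (tt j)) x <= beta j * norm_left N chi (tt j) x.

Lemma switched_norm_equiv : exists2 K, 0 < K & forall t x, 0 <= t ->
  N (chi t) x <= K * `|x| /\ `|x| <= K * N (chi t) x.
Proof.
have [D D0 ND] := N_equiv.
have [K1 K10 NK] := is_norm_le_mx_norm (N_norm (chi 0)).
have [K2 K20 KN] := mx_norm_le_is_norm (N_norm (chi 0)).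
have D10 : 0 < D * K1 by rewrite mulr_gt0.
have D20 : 0 < K2 * D by rewrite mulr_gt0.
exists (D * K1 + K2 * D); first by rewrite addr_gt0.
move=> t x t0; split.
  apply: (@le_trans _ _ (D * K1 * `|x|)).
    apply: (le_trans (ND t 0 x t0 (lexx 0))).
    by rewrite -mulrA ler_wpM2l ?(ltW D0).
  by rewrite ler_wpM2r// lerDl ltW.
apply: (@le_trans _ _ (K2 * D * N (chi t) x)).
  apply: (le_trans (KN x)); rewrite -mulrA ler_wpM2l ?(ltW K20)//.
  exact: ND.
by rewrite ler_wpM2r ?is_norm_ge0// lerDr ltW.
Qed.

Lemma nearby_solutions t0 t1 m e x : 0 <= t0 -> t0 <= t1 -> 0 < e ->
  lebesgue_integrable `[t0, t1] alpha -> (forall j, tt j <= t1 -> (j < m)%N) ->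
  caratheodory_solution f r t0 x -> (forall t, t0 <= t -> C (x t)) ->
  exists2 eta, 0 < eta & forall y, caratheodory_solution f r t0 y ->
    (forall t, t0 <= t -> C (y t)) -> N (chi t0) (y t0 - x t0) < eta ->
    N (chi t1) (y t1 - x t1) <=
      expR (lebesgue_int t0 t1 alpha + jump_sum tt beta m t0 t1 + e) *
      N (chi t0) (y t0 - x t0).
Proof.
move=> t00 t01 e0 ialpha ttm xsol Cx.
have [K K0 NK] := switched_norm_equiv.
pose e1 := e / 2 / (t1 - t0 + 1).
have t011 : 0 < t1 - t0 + 1 by lra.
have e10 : 0 < e1 by rewrite !divr_gt0.
have e20 : 0 < e / 2 by rewrite divr_gt0.
have icst := lebesgue_integrable_cst t0 t1 e1.
have tt_inj : injective tt.
  move=> i j ij; case: (ltngtP i j) => // /tt_incr; by rewrite ij ltxx.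
have [E E0 HE] := gronwall_jump _ tt beta _ _ _ m t01 e20
  (lebesgue_integrableD _ _ _ _ ialpha icst) ttm tt_inj beta_gt0.
have KK0 : 0 < K * K by rewrite mulr_gt0.
(* One factor [K] is lost in passing from the switched norm to the entrywise norm, another on the
   way back. *)
have eps0 : 0 < e1 / (K * K) by rewrite divr_gt0.
have [d d0 tube] := strict_differentiability_tube r_pwc t00 xsol Cx
  t1 (e1 / (K * K)) (N_norm (chi 0)) (C_reachable _ (lexx 0)) f_diff df_cont t01 eps0.
(* As long as the separation is at most [zeta] in the switched norm, [y] lies in the tube of radius
   [d] around [x]. *)
pose zeta := d / (2 * K); have zeta0 : 0 < zeta by rewrite divr_gt0// mulr_gt0.
have Kzeta : K * zeta < d.
  have -> : K * zeta = d / 2 by rewrite /zeta; field; rewrite lt0r_neq0.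
  lra.
exists (zeta / E); first by rewrite divr_gt0.
move=> y ysol Cy; rewrite ltr_pdivlMr// mulrC => small.
pose w t := y t - x t.
have wr t : t0 <= t -> w s @[s --> t^'+] --> w t.
  by move=> tt0; apply: cvgB; apply: (solution_right_continuous (f := f) (r := r) (t0 := t0)).
have wl t : t0 < t -> w s @[s --> t^'-] --> w t.
  by move=> tt0; apply: cvgB; apply: (solution_left_continuous (f := f) (r := r) (t0 := t0)).
have Nr t : t0 <= t -> \forall s \near t^'+, forall z, N (chi s) z <= K * `|z|.
  move=> tt0; near=> s => z; apply: (NK _ _ _).1.
  by rewrite (le_trans (le_trans t00 tt0))//; near: s; exact: nbhs_right_ge.
have Nl t : t0 < t -> \forall s \near t^'-, forall z, N (chi s) z <= K * `|z|.
  move=> tt0; near=> s => z; apply: (NK _ _ _).1.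
  by rewrite (le_trans t00)//; near: s; exact: nbhs_left_ge.
pose v t := N (chi t) (w t).
apply: (@le_trans _ _ (expR (lebesgue_int t0 t1 (fun t => alpha t + e1) +
    jump_sum tt beta m t0 t1 + e / 2) * v t0)).
  apply: (HE v zeta) => //.
  - by move=> t _; exact: is_norm_ge0.
  - move=> t /andP[tt0 tt1] vz tj e' e'0.
    have tge0 := le_trans t00 tt0.
    have mA := matrix_measure_growth N_norm t _ _ e'
      (alpha_bound t _ tge0 tj (Cx _ tt0)) e'0.
    set A := jacobian_mx _ _ in mA.
    have e'K0 : 0 < e' / (2 * K) by rewrite divr_gt0// mulr_gt0.
    have xd := solution_right_derivative r_pwc f_cont t00 xsol Cx t _ tt0 e'K0.
    have yd := solution_right_derivative r_pwc f_cont t00 ysol Cy t _ tt0 e'K0.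
    have NKt := Nr t tt0.
    have wd : `|w t| < d.
      by apply: le_lt_trans Kzeta; apply: (le_trans (NK _ _ tge0).2); rewrite ler_pM2l.
    have tt01 : t0 <= t <= t1 by rewrite tt0 ltW.
    have tubet := tube t (y t) tt01 (Cy _ tt0) wd.
    have {}tubet : `|f (y t) (r t) - f (x t) (r t) - A *m w t| <= e1 / (K * K) * `|w t|.
      exact: tubet.
    near=> s.
    have ts : t < s by near: s; exact: nbhs_right_gt.
    have h0 : 0 < s - t by rewrite subr_gt0.
    have mAs : forall z, N (chi s) ((1%:M + (s - t) *: A) *m z) <=
        (1 + (alpha t + e') * (s - t)) * N (chi t) z by near: s.
    have NKs : forall z, N (chi s) z <= K * `|z| by near: s.
    have xds : `|x s - x t - (s - t) *: f (x t) (r t)| <= e' / (2 * K) * (s - t).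
      by near: s.
    have yds : `|y s - y t - (s - t) *: f (y t) (r t)| <= e' / (2 * K) * (s - t).
      by near: s.
    have [ND NZ _] := N_norm (chi s).
    pose rho := f (y t) (r t) - f (x t) (r t) - A *m w t.
    pose rem := (y s - y t - (s - t) *: f (y t) (r t)) -
                (x s - x t - (s - t) *: f (x t) (r t)).
    (* The linear part is governed by the matrix measure, [rho] by strict differentiability, and
       [rem] by the right derivatives of the two solutions. *)
    have wsE : w s = (1%:M + (s - t) *: A) *m w t + ((s - t) *: rho + rem).
      rewrite /rho /rem !scalerBr mulmxDl mul1mx -scalemxAl.
      move: ((s - t) *: (A *m w t)) ((s - t) *: f (y t) (r t))
        ((s - t) *: f (x t) (r t)) => p q q'; rewrite /w.
      by apply/matrixP => i j; rewrite !mxE; ring.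
    have Nrho : N (chi s) ((s - t) *: rho) <= e1 * v t * (s - t).
      rewrite NZ gtr0_norm// mulrC ler_pM2r//; apply: (le_trans (NKs _)).
      apply: (@le_trans _ _ (K * (e1 / (K * K) * (K * v t)))).
        rewrite ler_pM2l//; apply: (le_trans tubet); rewrite ler_pM2l//.
        exact: (NK _ _ tge0).2.
      by rewrite le_eqVlt; apply/orP; left; apply/eqP; field; rewrite lt0r_neq0.
    have Nrem : N (chi s) rem <= e' * (s - t).
      apply: (le_trans (NKs _)).
      apply: (@le_trans _ _ (K * (e' / (2 * K) * (s - t) + e' / (2 * K) * (s - t)))).
        by rewrite ler_pM2l//; apply: (le_trans (ler_normB _ _)); exact: lerD.
      by rewrite le_eqVlt; apply/orP; left; apply/eqP; field; rewrite lt0r_neq0.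
    have := ND ((1%:M + (s - t) *: A) *m w t) ((s - t) *: rho + rem).
    have := ND ((s - t) *: rho) rem.
    rewrite -wsE -/(v s); have := mAs (w t); rewrite -/(v t).
    move: Nrho Nrem; lra.
  - move=> j /andP[tj0 _] e' e'0.
    have tjge0 := le_trans t00 tj0.
    have cv : v s @[s --> (tt j)^'+] --> v (tt j).
      exact: (switched_norm_cvg N_norm _ _ _ _ _ K0 (Nr _ tj0) (wr _ tj0)
        (N_right_cont _ tjge0 (w (tt j)))).
    move/cvgrPdist_le/(_ _ e'0) : cv; apply: filterS => s.
    rewrite distrC => H; have := le_trans (ler_norm _) H.
    by rewrite lerBlDl -/(v s) -/(v (tt j)).
  - move=> t /andP[tt0 _] tj.
    exact: (switched_norm_cvg N_norm _ _ _ _ _ K0 (Nl _ tt0) (wl _ tt0)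
      (N_left_cont _ (le_lt_trans t00 tt0) tj (w t))).
  - move=> j /andP[tj0 _]; exists (norm_left N chi (tt j) (w (tt j))).
      apply: (switched_norm_cvg N_norm _ _ _ _ _ K0 (Nl _ tj0) (wl _ tj0)).
      have [l Hl] := N_left_lim j (w (tt j)).
      by rewrite /norm_left; apply/cvg_ex; exists l.
    exact: beta_bound.
rewrite ler_wpM2r ?is_norm_ge0// ler_expR lebesgue_intD// lebesgue_int_cst//.
have : e1 * (t1 - t0) <= e / 2.
  rewrite /e1 mulrAC ler_pdivrMr// ler_pM2l//; lra.
lra.
Unshelve. all: by end_near. Qed.

Context {phi : R -> 'cV[R]_n -> R -> 'cV[R]_n}.
Hypothesis phi_sol : solution_map f r C phi.
Hypothesis C_invariant : forward_invariant f r C.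

Lemma flow_in t0 x0 : 0 <= t0 -> C x0 -> forall t, t0 <= t -> C (phi t0 x0 t).
Proof.
move=> t00 Cx0; have [phi0 sol] := phi_sol t0 x0 t00 Cx0.
by apply: C_invariant => //; rewrite phi0.
Qed.

Lemma flow_contraction : exists2 K, 0 < K & forall t0 t1 m x0 y0,
  0 <= t0 -> t0 <= t1 -> lebesgue_integrable `[t0, t1] alpha ->
  (forall j, tt j <= t1 -> (j < m)%N) -> C x0 -> C y0 ->
  N (chi t1) (phi t0 x0 t1 - phi t0 y0 t1) <=
    expR (lebesgue_int t0 t1 alpha + jump_sum tt beta m t0 t1) *
    (K * N (chi 0) (x0 - y0)).
Proof.
have [D D0 ND] := N_equiv.
have [kappa kappa0 reach] := C_reachable _ (lexx 0).
exists (D * kappa); first by rewrite mulr_gt0.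
move=> t0 t1 m x0 y0 t00 t01 ialpha ttm Cx0 Cy0.
set S := lebesgue_int _ _ _ + _; set L := D * kappa * _.
have L0 : 0 <= L by rewrite !mulr_ge0 ?is_norm_ge0 ?ltW.
have [gam [[gam0 gam1] Cgam dgam _ gamN]] := reach _ _ Cx0 Cy0.
(* The slack [e] enters twice: in the growth of nearby solutions, and as a strict margin on the
   speed of the curve that also keeps [L + e] positive when [x0 = y0]. *)
have H e : 0 < e -> N (chi t1) (phi t0 x0 t1 - phi t0 y0 t1) <=
    expR (S + e) * (L + e).
  move=> e0; rewrite is_normC// -[leRHS]mulr1 -[X in _ * X]subr0 -gam0 -gam1.
  apply: (pointwise_lipschitz_le (N_norm (chi t1)) (fun s => phi t0 (gam s) t1)) => // s s01.
  have s01' : s \in `[0, 1] by rewrite in_itv.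
  have Cs := Cgam _ s01'; have [phis sols] := phi_sol _ _ t00 Cs.
  have [eta eta0 Heta] := nearby_solutions _ _ m e _ t00 t01 e0 ialpha ttm sols
    (flow_in _ _ t00 Cs).
  have Ngam : N (chi t0) (derive1 gam s) < L + e.
    apply: (@le_lt_trans _ _ L); last by rewrite ltrDl.
    apply: (le_trans (ND t0 0 _ t00 (lexx 0))); rewrite /L -mulrA ler_pM2l//.
    exact: gamN.
  have [d d0 Hd] := is_norm_derivable_local (N_norm (chi t0)) _ _ _ (dgam _ s01') Ngam.
  have Le0 : 0 < L + e by rewrite ltr_wpDl.
  exists (Num.min d (eta / (L + e))); first by rewrite lt_min d0 divr_gt0.
  move=> s' s01s'; rewrite lt_min ltr_pdivlMr// => /andP[/Hd Hs' s'eta].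
  have Cs' : C (gam s') by apply: Cgam; rewrite in_itv.
  have [phis' sols'] := phi_sol _ _ t00 Cs'.
  have := Heta _ sols' (flow_in _ _ t00 Cs').
  rewrite phis phis' => Hphi; rewrite -mulrA.
  apply: (le_trans (Hphi _)); last by rewrite ler_pM2l// expR_gt0.
  by apply: (le_lt_trans Hs'); rewrite mulrC.
have cvS : expR (S + e) * (L + e) @[e --> 0^'+] --> expR (S + 0) * (L + 0).
  apply: cvg_at_right_filter; apply: cvgM.
    apply: continuous_cvg; first exact: continuous_expR.
    by apply: cvgD; [exact: cvg_cst|exact: cvg_id].
  by apply: cvgD; [exact: cvg_cst|exact: cvg_id].
rewrite !addr0 in cvS; apply: (cvgr_to_ge cvS).
by near=> e; apply: H; near: e; exact: nbhs_right_gt.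
Unshelve. all: by end_near. Qed.

Hypothesis tt_locfin : forall a b : R, finite_set [set j | a <= tt j <= b].

(** The growth exponent omits a jump at [t0 + T], whereas [jump_sum] would count it. The contraction
    estimate is therefore applied at times [s] before [t0 + T], and in the fixed norm both sides
    pass to the limit. *)
Lemma flow_growth : exists2 K, 0 < K & forall t0 T x0 y0,
  0 <= t0 -> 0 < T -> lebesgue_integrable `[t0, t0 + T] alpha -> C x0 -> C y0 ->
  N (chi 0) (phi t0 x0 (t0 + T) - phi t0 y0 (t0 + T)) <=
    K * N (chi 0) (x0 - y0) * expR (growth_exponent alpha tt beta t0 T).
Proof.
have [D D0 ND] := N_equiv; have [K K0 HK] := flow_contraction.
have [K1 K10 NK1] := is_norm_le_mx_norm (N_norm (chi 0)).
exists (D * K); first by rewrite mulr_gt0.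
move=> t0 T x0 y0 t00 T0 ialpha Cx0 Cy0.
set t1 := t0 + T; have t01 : t0 < t1 by rewrite ltrDl.
have [m ttm] := exists_jump_bound tt tt_gt0 tt_incr tt_locfin t1.
rewrite /growth_exponent (fsum_jumps tt beta m t0 t1 ttm).
set H := \sum_(j < m | _) _.
pose w s := phi t0 x0 s - phi t0 y0 s.
have cw : w s @[s --> t1^'-] --> w t1.
  have [_ solx] := phi_sol _ _ t00 Cx0; have [_ soly] := phi_sol _ _ t00 Cy0.
  by apply: cvgB; exact: (solution_left_continuous solx) ||
    exact: (solution_left_continuous soly).
have cN : N (chi 0) (w s) @[s --> t1^'-] --> N (chi 0) (w t1).
  have NK1' : \forall s \near t1^'-, forall y, N (chi 0) y <= K1 * `|y|.
    by near=> s; exact: NK1.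
  exact: (switched_norm_cvg (chi := fun=> chi 0) N_norm _ _ _ _ _ K10 NK1' cw (cvg_cst _)).
have cint : lebesgue_int t0 s alpha @[s --> t1^'-] --> lebesgue_int t0 t1 alpha.
  apply/cvgrPdist_le => e e0.
  have [d d0 Hd] := lebesgue_int_uniform_continuous _ _ _ _ e0 ialpha.
  near=> s; apply/ltW/Hd => //.
  - by near: s; exact: nbhs_left_ge.
  - rewrite ltrBlDr addrC -ltrBlDr; near: s; apply: nbhs_left_gt.
    by rewrite ltrBlDr ltrDl.
have cR : D * K * N (chi 0) (x0 - y0) * expR (lebesgue_int t0 s alpha + H)
    @[s --> t1^'-] -->
    D * K * N (chi 0) (x0 - y0) * expR (lebesgue_int t0 t1 alpha + H).
  apply: cvgMr; apply: continuous_cvg; first exact: continuous_expR.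
  by apply: cvgD => //; exact: cvg_cst.
apply: (ler_cvg_to cN cR); near=> s.
have st : s <= t1 by near: s; exact: nbhs_left_le.
have ts : t0 <= s by near: s; exact: nbhs_left_ge.
have Hs : jump_sum tt beta m t0 s = H by near: s; exact: jump_sum_near_left.
apply: (le_trans (ND 0 s _ (lexx 0) (le_trans t00 ts))).
rewrite -!mulrA ler_pM2l// mulrA [leRHS]mulrC -Hs; apply: HK => //.
  exact: lebesgue_integrable_sub ialpha.
by move=> j js; apply: ttm; exact: le_trans st.
Unshelve. all: by end_near. Qed.

End flow.

(** * Exponential comparison functions *)

(** Controls the transient phase, on which the averaged condition is silent. The bound depends on
    [t0]. *)
Lemma growth_exponent_bounded {R : realType} (alpha : R -> R) (tt beta : nat -> R)
    (t0 T0 : R) :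
  (forall j, 0 < tt j) -> (forall i j, (i < j)%N -> tt i < tt j) ->
  (forall a b : R, finite_set [set j | a <= tt j <= b]) ->
  lebesgue_integrable `[t0, t0 + T0] alpha ->
  exists M, forall T, 0 <= T <= T0 -> growth_exponent alpha tt beta t0 T <= M.
Proof.
move=> tt_gt0 tt_incr tt_locfin ialpha.
have [m ttm] := exists_jump_bound tt tt_gt0 tt_incr tt_locfin (t0 + T0).
exists (lebesgue_int t0 (t0 + T0) (fun t => `|alpha t|) + \sum_(j < m) `|ln (beta j)|).
move=> T /andP[T_ge0 TT0]; rewrite /growth_exponent.
have TT0' : t0 + T <= t0 + T0 by rewrite lerD2l.
have t0T : t0 <= t0 + T by rewrite lerDl.
rewrite (fsum_jumps tt beta m); last by move=> j jT; apply: ttm; exact: le_trans TT0'.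
apply: lerD.
  have iT : lebesgue_integrable `[t0, t0 + T] alpha by exact: lebesgue_integrable_sub ialpha.
  have inorm : lebesgue_integrable `[t0, t0 + T0] (fun t => `|alpha t|).
    exact: (integrable_norm ialpha).
  rewrite (lebesgue_int_split _ _ _ _ t0T TT0' inorm).
  apply: (le_trans (ler_norm _)).
  apply: (le_trans (le_normr_Rintegral (lebesgueR_measurable_itv _) iT)).
  by rewrite lerDl Rintegral_ge0.
rewrite big_mkcond; apply: ler_sum => j _; case: ifP => // _; exact: ler_norm.
Qed.

Lemma class_EKL_exponential {R : realType} (K c : R) : 0 < K -> 0 < c ->
  class_EKL +oo%E (fun u t => K * u * expR (- (c * t))).
Proof.
move=> K0 c0.
have cont2 : continuous (fun p : R * R => K * p.1 * expR (- (c * p.2))).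
  move=> p; apply: cvgM; first by apply: cvgMr; exact: cvg_fst.
  apply: continuous_cvg; first exact: continuous_expR.
  by apply: cvgN; apply: cvgMr; exact: cvg_snd.
split; last first.
  exists c => // u u0 _; exists (K * u) => t _; exact: lexx.
split.
- exact: continuous_subspaceT.
- move=> t t0; split.
  + apply: continuous_subspaceT => u; apply: cvgMl; apply: cvgMr; exact: cvg_id.
  + by move=> u [u0 _]; rewrite !mulr_ge0 ?expR_ge0// ltW.
  + by move=> u v _ _ uv; rewrite ltr_pM2r ?expR_gt0// ltr_pM2l.
  + by rewrite mulr0 mul0r.
- move=> u s t u0 _ s0 st; apply: ler_wpM2l; first by rewrite mulr_ge0// ltW.
  by rewrite ler_expR lerN2 ler_pM2l.
- move=> u u0 _; rewrite -[X in _ --> X](mulr0 (K * u)); apply: cvgMr.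
  have ct : c * t @[t --> +oo] --> +oo by exact: (gt0_cvgMry c0 cvg_id).
  exact: (cvg_comp _ _ ct (@cvgr_expR R)).
Qed.

(** For [T <= T0] the factor [expR (c * T0)] compensates the decay [expR (- (c * T))]; the absolute
    value of [M] makes the same constant valid afterwards. *)
Lemma contraction_transient {R : realType} (E : R -> R) (c T0 M T : R) :
  0 < c -> 0 < T0 -> (forall T, T0 < T -> T^-1 * E T < - c) ->
  (forall T, 0 <= T <= T0 -> E T <= M) -> 0 < T ->
  expR (E T) <= expR (`|M| + c * T0) * expR (- (c * T)).
Proof.
move=> c0 T00 EcT EM T_gt0; rewrite -expRD ler_expR.
have M0 : 0 <= `|M| by [].
have cT0 : 0 < c * T0 by rewrite mulr_gt0.
have [TT0|T0T] := leP T T0.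
  have : E T <= `|M| by apply: le_trans (ler_norm M); apply: EM; rewrite ltW.
  have : c * T <= c * T0 by rewrite ler_pM2l.
  lra.
have /ltW := EcT _ T0T; rewrite ler_pdivrMl//; lra.
Qed.

(** The averaged condition constrains only long horizons. In the uniform clause the overshoot before
    [Tu] is therefore bounded by an [M] common to all [t0]. The rate clause starts after [T0 t0],
    where the condition applies directly and [K] does not depend on [t0]. *)
Theorem theorem1 (R : realType) (n : nat) (C : set 'cV[R]_n)
    (r : R -> R) (f : 'cV[R]_n -> R -> 'cV[R]_n)
    (phi : R -> 'cV[R]_n -> R -> 'cV[R]_n)
    (I : topologicalType) (N : I -> 'cV[R]_n -> R) (chi : R -> I)
    (tt beta : nat -> R) (alpha : R -> R) (c T0 : R -> R)
    (r_pwc : piecewise_continuous r)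
    (phi_sol : solution_map f r C phi)
    (* (1) regularity of the vector field *)
    (f_cont : {within C `*` setT,
       continuous (fun p : 'cV[R]_n * R => f p.1 p.2)})
    (f_diff : forall x u, C x -> differentiable (f ^~ u) x)
    (df_cont : {within C `*` setT,
       continuous (fun p : 'cV[R]_n * R => jacobian_mx (f ^~ p.2) p.1)})
    (f_bound : exists2 m : R -> R, lebesgue_measurable_fun `[0, +oo[ m &
       forall x t, C x -> 0 <= t -> `|f x (r t)| <= m t)
    (* (2) the switched norm and its jump instants *)
    (N_norm : forall k, is_norm (N k))
    (chi_pwc : piecewise_continuous chi)
    (tt_gt0 : forall j, 0 < tt j)
    (tt_incr : forall i j, (i < j)%N -> tt i < tt j)
    (tt_locfin : forall a b : R, finite_set [set j | a <= tt j <= b])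
    (N_regular : forall t, 0 <= t -> (forall j, t <> tt j) ->
       right_regular N chi t)
    (N_right_cont : forall t, 0 <= t -> norm_right_continuous N chi t)
    (N_equiv : uniformly_equivalent N chi)
    (N_left_lim : forall j, norm_left_limit_exists N chi (tt j))
    (N_left_cont : forall t, 0 < t -> (forall j, t <> tt j) ->
       norm_left_continuous N chi t)
    (* (3) the set C *)
    (C_reachable : forall t0, 0 <= t0 -> kappa_reachable (N (chi t0)) C)
    (C_invariant : forward_invariant f r C)
    (alpha_meas : lebesgue_measurable_fun `[0, +oo[ alpha)
    (beta_ge0 : forall j, 0 <= beta j)
    (alpha_bound : forall t x, 0 <= t -> (forall j, t <> tt j) -> C x ->
       (matrix_measure N chi t (jacobian_mx (f ^~ (r t)) x) <=
        (alpha t)%:E)%E)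
    (beta_bound : forall j x,
       N (chi (tt j)) x <= beta j * norm_left N chi (tt j) x)
    (c_gt0 : forall t0, 0 <= t0 -> 0 < c t0)
    (T0_gt0 : forall t0, 0 <= t0 -> 0 < T0 t0)
    (contraction : forall t0, 0 <= t0 ->
       average_contraction alpha tt beta t0 (c t0) (T0 t0)) :
  [/\ dEAS C phi,
      forall cu Tu : R, 0 < cu -> 0 < Tu ->
        (forall t0, 0 <= t0 -> average_contraction alpha tt beta t0 cu Tu) ->
        (exists M : R, forall t0 T, 0 <= t0 -> 0 <= T <= Tu ->
           growth_exponent alpha tt beta t0 T <= M) ->
        dUEAS C phi &
      exists2 N0 : 'cV[R]_n -> R, is_norm N0 & exists2 K : R, 0 < K &
        forall t0 t x0 y0, 0 <= t0 -> C x0 -> C y0 -> T0 t0 < t - t0 ->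
          N0 (phi t0 x0 t - phi t0 y0 t) <=
            K * N0 (x0 - y0) * expR (- (c t0 * (t - t0)))].
Proof.
set N0 := N (chi 0); have N0_norm : is_norm N0 by exact: N_norm.
have bound : exists2 K, 0 < K & forall t0 T x0 y0,
    0 <= t0 -> 0 < T -> lebesgue_integrable `[t0, t0 + T] alpha -> C x0 -> C y0 ->
    N0 (phi t0 x0 (t0 + T) - phi t0 y0 (t0 + T)) <=
      K * N0 (x0 - y0) * expR (growth_exponent alpha tt beta t0 T).
  (* A zero [beta j], for which [ln] takes the default value 0, would annihilate the norm of a
     nonzero vector. In the trivial space both sides of the estimate vanish. *)
  have [[z z0]|triv] := pselect (exists z : 'cV[R]_n, z != 0); last first.
    have triv0 z : z = 0 :> 'cV[R]_n.
      by apply/eqP/negPn/negP => z0; apply: triv; exists z.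
    exists 1 => // t0 T x0 y0 _ _ _ _ _.
    by rewrite (triv0 (_ - _)) (triv0 (x0 - y0)) is_norm0// mulr0 mul0r.
  have beta_gt0 j : 0 < beta j.
    rewrite lt_neqAle beta_ge0 andbT; apply/eqP => b0.
    have [_ _ H] := N_norm (chi (tt j)).
    have := beta_bound j z; rewrite -b0 mul0r => Nz.
    have /H z00 : N (chi (tt j)) z = 0.
      by apply/eqP; rewrite eq_le Nz is_norm_ge0.
    by move: z0; rewrite z00 eqxx.
  exact: (flow_growth r_pwc f_cont f_diff df_cont N_norm tt_gt0 tt_incr
    N_right_cont N_equiv N_left_lim N_left_cont C_reachable beta_gt0 alpha_bound
    beta_bound phi_sol C_invariant tt_locfin).
have [K K0 HK] := bound.
have transient t0 ct Tt M : 0 <= t0 -> 0 < ct -> 0 < Tt ->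
    average_contraction alpha tt beta t0 ct Tt ->
    (forall T, 0 <= T <= Tt -> growth_exponent alpha tt beta t0 T <= M) ->
    incremental_bound C phi N0 +oo%E
      (fun u t => (K + 1) * expR (`|M| + ct * Tt) * u * expR (- (ct * t))) t0.
  move=> t00 ct0 Tt0 contr HM x0 y0 Cx0 Cy0; split; first by rewrite ltry.
  move=> t t_ge0; rewrite (addrC t t0).
  (* A coefficient of at least 1 is needed at [t = 0], where the left-hand side is the initial
     distance itself. *)
  have K1 : 1 <= K + 1 by rewrite lerDr ltW.
  have e1 : 1 <= expR (`|M| + ct * Tt).
    by rewrite -expR0 ler_expR addr_ge0// mulr_ge0// ltW.
  move: t_ge0; rewrite le_eqVlt => /predU1P[<-|t_gt0].
    have [phix _] := phi_sol t0 x0 t00 Cx0; have [phiy _] := phi_sol t0 y0 t00 Cy0.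
    rewrite addr0 phix phiy mulr0 oppr0 expR0 mulr1.
    by rewrite ler_peMl ?is_norm_ge0// mulr_ege1.
  (* The averaged condition yields integrability only on intervals longer than [Tt], so it is
     restricted from length [t + Tt]. *)
  have iT : lebesgue_integrable `[t0, t0 + t] alpha.
    have [|i _] := contr (t + Tt); first by rewrite ltrDr.
    by apply: lebesgue_integrable_sub i => //; rewrite lerD2l lerDl ltW.
  apply: (le_trans (HK _ _ _ _ t00 t_gt0 iT Cx0 Cy0)).
  have := contraction_transient _ _ _ M t ct0 Tt0
    (fun T TT => (contr T TT).2) HM t_gt0.
  move=> Ht; apply: (@le_trans _ _ ((K + 1) * N0 (x0 - y0) *
      (expR (`|M| + ct * Tt) * expR (- (ct * t))))); last by rewrite !mulrA (mulrAC (K + 1)).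
  apply: ler_pM => //; [by rewrite mulr_ge0 ?is_norm_ge0// ltW|].
  by rewrite ler_wpM2r ?is_norm_ge0// lerDl.
have coef_gt0 x : 0 < (K + 1) * expR x by rewrite mulr_gt0 ?expR_gt0// addr_gt0.
split.
- exists N0 => // t0 t00.
  have [|i _] := contraction _ t00 (T0 t0 + 1); first by rewrite ltrDl.
  have i' : lebesgue_integrable `[t0, t0 + T0 t0] alpha.
    by apply: lebesgue_integrable_sub i => //; rewrite lerD2l lerDl.
  have [M HM] := growth_exponent_bounded alpha tt beta t0 (T0 t0) tt_gt0 tt_incr
    tt_locfin i'.
  exists +oo%E, (fun u t => (K + 1) * expR (`|M| + c t0 * T0 t0) * u * expR (- (c t0 * t))).
  split => //; first by apply: class_EKL_exponential => //; exact: c_gt0.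
  by apply: transient => //; [exact: c_gt0|exact: T0_gt0|exact: contraction].
- move=> cu Tu cu0 Tu0 contr [M HM]; exists N0 => //.
  exists +oo%E, (fun u t => (K + 1) * expR (`|M| + cu * Tu) * u * expR (- (cu * t))).
  split => //; first exact: class_EKL_exponential.
  by move=> t0 t00; apply: transient => //; [exact: contr|move=> T; exact: HM].
- exists N0 => //; exists K => // t0 t x0 y0 t00 Cx0 Cy0 tT0.
  have T_gt0 : 0 < t - t0 := lt_trans (T0_gt0 _ t00) tT0.
  have [i Ht] := contraction _ t00 _ tT0.
  have := HK _ _ _ _ t00 T_gt0 i Cx0 Cy0; rewrite (addrC t0) subrK.
  move=> /le_trans; apply; rewrite ler_wpM2l ?mulr_ge0 ?is_norm_ge0 ?(ltW K0)//.
  by rewrite ler_expR; move/ltW: Ht; rewrite ler_pdivrMl// mulrN mulrC.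
Qed.
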